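(* Let $M$ be a regular matroid of rank six with ground set $E(M)$, and let $\mu$ be a probability distribution on $E(M)$. Then there exist cocircuits $C_1^*$, $C_2^*$, and $C_3^*$ of $M$ satisfying $$\mu(C_1^* )+\mu(C_2^* )+\mu(C_3^* )\leq 1$$ and with the property that $C_h^*\not\subseteq C_i^*\cup C_j^*$ for all $\{h,i,j\}=\{1,2,3\}$.
   Context: Matroids are finite. A probability distribution on $E(M)$ is a function $\mu:E(M)\to\mathbb{R}_{\geq 0}$ with $\sum_{e\in E(M)}\mu(e)=1$. For $X\subseteq E(M)$, $\mu(X)=\sum_{e\in X}\mu(e)$. *)

(* Defs.v *)
From HB Require Import structures.
From mathcomp Require Import all_boot all_order all_algebra.
From mathcomp Require Import reals.

Set Implicit Arguments.
Unset Strict Implicit.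
Unset Printing Implicit Defensive.

Import Order.TTheory GRing.Theory Num.Theory.

(* The ground set of a matroid is the whole finite type E. *)
Record matroid (E : finType) := Matroid {
  indep : pred {set E};
  indep0 : indep set0;
  indepS : forall I J : {set E}, I \subset J -> indep J -> indep I;
  indep_aug : forall I J : {set E}, indep I -> indep J -> #|I| < #|J| ->
    exists2 e, e \in J :\: I & indep (e |: I)
}.

Section Matroid.
Variables (E : finType) (M : matroid E).
Implicit Types I J X B C : {set E}.

Definition rank : nat := \max_(I : {set E} | indep M I) #|I|.

Definition base B : bool := maxset (indep M) B.

Definition circuit C : bool := minset (fun X => ~~ indep M X) C.

Lemma indep_extend I J : indep M I -> base J ->
  exists2 B, base B & (I \subset B) && (B \subset I :|: J).
Proof.
move=> indI /maxsetP[indJ maxJ].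
have [B /maxsetP[/andP[indB sBU] maxB] sIB] :
    {B | maxset [pred X | indep M X && (X \subset I :|: J)] B & I \subset B}.
  by apply: maxset_exists; rewrite /= indI subsetUl.
have leJB : #|J| <= #|B|.
  rewrite leqNgt; apply/negP => /(indep_aug indB indJ)[e].
  rewrite inE => /andP[eNB eJ] indeB.
  have /setP/(_ e) : e |: B = B.
    apply: maxB (subsetUr _ _); rewrite /= indeB subUset sBU sub1set inE eJ.
    by rewrite orbT.
  by rewrite !inE eqxx /= => /esym; apply/negP.
exists B; last by rewrite sIB.
apply/maxsetP; split=> // X indX sBX; apply/eqP.
rewrite eq_sym eqEcard sBX /= (leq_trans _ leJB) // leqNgt; apply/negP.
move=> /(indep_aug indJ indX)[e]; rewrite inE => /andP[eNJ eX] indeJ.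
have /setP/(_ e) := maxJ _ indeJ (subsetUr _ _).
by rewrite !inE eqxx /= => /esym; apply/negP.
Qed.

Lemma card_base B1 B2 : base B1 -> base B2 -> #|B1| = #|B2|.
Proof.
suff le A B : base A -> base B -> #|A| <= #|B|.
  by move=> b1 b2; apply/eqP; rewrite eqn_leq !le.
move=> /maxsetP[indA _] /maxsetP[indB maxB]; rewrite leqNgt; apply/negP.
move=> /(indep_aug indB indA)[e]; rewrite inE => /andP[eNB eA] indeB.
have /setP/(_ e) := maxB _ indeB (subsetUr _ _).
by rewrite !inE eqxx /= => /esym; apply/negP.
Qed.

Definition dual_indep X : bool := [exists B, base B && [disjoint X & B]].

Lemma dual_indep0 : dual_indep set0.
Proof.
have [B bB _] := maxset_exists (indep0 M).
by apply/existsP; exists B; rewrite /base bB -setI_eq0 set0I eqxx.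
Qed.

Lemma dual_indepS I J : I \subset J -> dual_indep J -> dual_indep I.
Proof.
move=> sIJ /existsP[B /andP[bB dJB]]; apply/existsP; exists B.
by rewrite bB (disjointWl sIJ).
Qed.

Lemma dual_indep_aug I J : dual_indep I -> dual_indep J -> #|I| < #|J| ->
  exists2 e, e \in J :\: I & dual_indep (e |: I).
Proof.
move=> /existsP[BI /andP[bBI dI]] /existsP[BJ /andP[bBJ dJ]] ltIJ.
have indD : indep M (BJ :\: I).
  by apply: indepS (subsetDl _ _) _; case/maxsetP: bBJ.
have [B bB /andP[sDB sBU]] := indep_extend indD bBI.
have dIB : [disjoint I & B].
  rewrite disjoint_subset; apply/subsetP => x xI; apply/negP => xB.
  by have := subsetP sBU x xB; rewrite !inE xI (disjointFr dI xI).
have [sJB | /subsetPn[e eD eNB]] := boolP (J :\: I \subset B); last first.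
  exists e => //; apply/existsP; exists B.
  by rewrite bB -setI_eq0 setIUl setU_eq0 !setI_eq0 dIB disjoints1 eNB.
have dD : [disjoint J :\: I & BJ :\: I].
  by apply: disjointW dJ; apply: subsetDl.
have : #|(J :\: I) :|: (BJ :\: I)| <= #|B|.
  by apply: subset_leq_card; rewrite subUset sJB.
rewrite cardsU (disjoint_setI0 dD) cards0 subn0 (card_base bB bBJ).
have : #|BJ :&: I| <= #|I :\: J|.
  apply/subset_leq_card/subsetP => x; rewrite !inE => /andP[xB xI].
  by rewrite xI (contraTN _ xB) // => xJ; rewrite (disjointFr dJ xJ).
have := cardsID I BJ; have := cardsID I J; have := cardsID J I.
rewrite (setIC J I) => hI hJ hB le1 le2; exfalso; move: ltIJ.
rewrite -hI -hJ ltn_add2l ltnNge => /negP; apply.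
by rewrite -(leq_add2r #|BJ :\: I|) (leq_trans le2) // -hB leq_add2r.
Qed.

Definition dual : matroid E :=
  Matroid dual_indep0 dual_indepS dual_indep_aug.

End Matroid.

Definition cocircuit (E : finType) (M : matroid E) (C : {set E}) : bool :=
  circuit (dual M) C.

Local Open Scope ring_scope.

(* The columns of A are indexed by E through enum_rank; [free] is linear
   independence of the family, so repeated columns are dependent. *)
Definition represents (F : fieldType) (m : nat) (E : finType)
    (A : 'M[F]_(m, #|E|)) (M : matroid E) : Prop :=
  forall X : {set E},
    indep M X = free [seq col (enum_rank e) A | e <- enum X].

Definition totally_unimodular (R : realType) (m n : nat) (A : 'M[R]_(m, n)) :
    Prop :=
  forall (k : nat) (f : 'I_k -> 'I_m) (g : 'I_k -> 'I_n),
    injective f -> injective g ->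
    \det (mxsub f g A) \in [:: 0; 1; -1].

Definition regular (R : realType) (E : finType) (M : matroid E) : Prop :=
  exists (m : nat) (A : 'M[R]_(m, #|E|)),
    totally_unimodular A /\ represents A M.

Definition prob_dist (R : realType) (E : finType) (mu : E -> R) : Prop :=
  (forall e, 0 <= mu e) /\ \sum_e mu e = 1.

(* Main.v *)
From Stdlib Require Import NArith.
Require Import Defs.
From mathcomp Require Import all_boot all_order all_algebra.
From mathcomp Require Import reals.
From mathcomp Require Import ring lra zify.

Set Implicit Arguments.
Unset Strict Implicit.
Unset Printing Implicit Defensive.

Import Order.TTheory GRing.Theory Num.Theory.
Local Open Scope ring_scope.

(* Reduced modulo 2, a totally unimodular representation gives vectors in F_2^6
   with no Fano minor; this is all that is used of regularity. The complement
   of a cocycle being a flat, a cocycle (the support of a linear functional)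
   contains a cocircuit through each of its elements. So it suffices to find
   three cocycles of total weight at most 1, each with an element outside the
   other two. For positive weights, a lightest linearly independent triple of
   functionals can be chosen with this property; a perturbation then handles
   zero weights, and it is enough to find three independent functionals of
   total weight at most 1.
   This is a finite problem: by linear programming duality, a set T of vectors
   has such a triple for all weights if and only if some probability
   distribution on independent triples loads each vector of T at most 1 on
   average. A branching search over Fano-free configurations, up to linear
   isomorphism, finds that these distributions always exist (with
   equality for the cographic matroid of the Petersen graph); its trace is
   checked here by computation. *)

(** * Binary configurations *)

(* Linear independence over F_2, for [V] of characteristic 2. *)
Definition indep3 (V : zmodType) (x y z : V) : bool :=
  [&& x != 0, y != 0, z != 0, x + y != 0, x + z != 0, y + z != 0
    & x + y + z != 0].

Section BinaryConfigurations.
Variables (R : realType) (E : finType).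
Implicit Types (c : E -> 'cV[bool]_6) (w : E -> R) (B : 'M[bool]_6).

Definition cocycle n (c : E -> 'cV[bool]_n) (y : 'rV[bool]_n) : {set E} :=
  [set e | (y *m c e) 0 0].

(** The bound is homogeneous in [w], so the weights are not normalized; the perturbation argument
    applies it to weights of arbitrary total. *)
Definition light_triples c : Prop := forall w, (forall e, 0 <= w e) ->
  exists y : 'rV[bool]_6 * 'rV[bool]_6 * 'rV[bool]_6,
    indep3 y.1.1 y.1.2 y.2 /\
    \sum_(e in cocycle c y.1.1) w e + \sum_(e in cocycle c y.1.2) w e
      + \sum_(e in cocycle c y.2) w e <= \sum_e w e.

Definition coords B c (e : E) : bool * bool * bool :=
  let v := invmx B *m c e in (v (inord 0) 0, v (inord 1) 0, v (inord 2) 0).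

(* [B] exhibits the minor: contract its last three columns; its first three
   columns are the remaining points of the plane. *)
Definition fano_free c : Prop := forall B, B \in unitmx ->
  (forall j, exists e, c e = col j B) ->
  ~ forall t, t \in [:: (true, true, false); (true, false, true);
                        (false, true, true); (true, true, true)] ->
      exists e, coords B c e = t.

Lemma fano_free_unit c B : B \in unitmx ->
  fano_free c -> fano_free (fun e => invmx B *m c e).
Proof.
move=> uB ffc A uA colA fan; apply: (ffc (B *m A)).
- by rewrite unitmx_mul uB.
- move=> j; have [e he] := colA j; exists e.
  by rewrite -(mulKVmx uB (c e)) he !colE mulmxA.
move=> t /fan[e <-]; exists e.
rewrite /coords.
suff -> : invmx (B *m A) *m c e = invmx A *m (invmx B *m c e) by [].
have uBA : B *m A \in unitmx by rewrite unitmx_mul uB.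
by apply: (can_inj (mulKmx uBA)); rewrite mulKVmx // -mulmxA mulKVmx // mulKVmx.
Qed.

(** The functional [y] on the new coordinates is [y *m invmx B] on the old ones, with the same
    cocycle. *)
Lemma light_triples_unit c B : B \in unitmx ->
  light_triples (fun e => invmx B *m c e) -> light_triples c.
Proof.
move=> uB gc w w0; have [[[y1 y2] y3] /= [ind le]] := gc w w0.
have cocE y : cocycle c (y *m invmx B) = cocycle (fun e => invmx B *m c e) y.
  by apply/setP => e; rewrite !inE mulmxA.
have eq0 (y : 'rV_6) : (y *m invmx B == 0) = (y == 0).
  by rewrite -(inj_eq (can_inj (mulmxK uB))) mulmxKV // mul0mx.
exists (y1 *m invmx B, y2 *m invmx B, y3 *m invmx B) => /=.
by rewrite !cocE /indep3 -!mulmxDl !eq0.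
Qed.

(** Vectors are coded by the six lowest binary digits, so that addition becomes [N.lxor] and the
    search can be replayed by fast computation. *)
Definition vec (m : N) : 'cV[bool]_6 := \col_i N.testbit m (N.of_nat i).

Definition contains c (I : seq N) : Prop :=
  forall m, m \in I -> exists e, c e = vec m.

(** The claim that the search establishes for a pattern [I]. A configuration may contain any further
    vectors, so a settled pattern can be reused wherever it occurs. *)
Definition forces_light (I : seq N) : Prop :=
  forall c, fano_free c -> contains c I -> light_triples c.

(** A linearly isomorphic copy of a pattern serves as well as the pattern itself; this lets the
    search work up to isomorphism. *)
Lemma forces_light_unit I c B : B \in unitmx -> fano_free c ->
  (forall m, m \in I -> exists e, c e = B *m vec m) -> forces_light I -> light_triples c.
Proof.
move=> uB ffc cI pI; apply: (light_triples_unit uB); apply: pI.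
  exact: fano_free_unit.
by move=> m /cI[e he]; exists e; rewrite he mulKmx.
Qed.

End BinaryConfigurations.

(** * Checking a trace of the search *)

Section Checker.
Local Open Scope N_scope.

Definition std_basis : seq N := [:: 1; 2; 4; 8; 16; 32].
Definition all_vectors : seq N := [seq N.of_nat i | i <- iota 0 64].

Definition bit (m : N) (i : nat) : bool := N.testbit m (N.of_nat i).

(* The linear combination of [b] whose coefficients are the bits of [m]. *)
Fixpoint comb (b : seq N) (m : N) : N :=
  if b is v :: b' then
    if N.odd m then N.lxor v (comb b' (N.div2 m)) else comb b' (N.div2 m)
  else 0.

Definition dot (a b : N) : bool :=
  let m := N.land a b in
  bit m 0 (+) (bit m 1 (+) (bit m 2 (+) (bit m 3 (+) (bit m 4 (+) bit m 5)))).

Definition memN (m : N) (s : seq N) : bool := has (N.eqb m) s.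

(** Six vectors whose 64 combinations include the unit vectors span, hence form a basis. *)
Definition is_basis (b : seq N) : bool :=
  (size b == 6)%nat &&
  let s := [seq comb b m | m <- all_vectors] in all (fun m => memN m s) std_basis.

(** The numbers 3, 5, 6, 7 are the digit patterns of the four missing points of the plane, and
    [8 * t] runs over the combinations of the last three basis vectors, which are contracted. *)
Definition is_fano (S b : seq N) : bool :=
  [&& is_basis b, all (fun m => memN m S) b
    & all (fun m => has (fun t => memN (comb b (m + 8 * t)) S)
                        [:: 0; 1; 2; 3; 4; 5; 6; 7])
          [:: 3; 5; 6; 7]].

Definition is_embedding (S I b : seq N) : bool :=
  is_basis b && all (fun m => memN (comb b m) S) I.

Definition nonzero (m : N) : bool := has (bit m) [:: 0; 1; 2; 3; 4; 5]%nat.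

Definition indep3N (x y z : N) : bool :=
  all nonzero
    [:: x; y; z; N.lxor x y; N.lxor x z; N.lxor y z; N.lxor (N.lxor x y) z].

Definition triple := (N * (N * N * N))%type.

Definition load (v : N) (p : triple) : N :=
  let: (k, (x, y, z)) := p in
  k * (N.b2n (dot x v) + N.b2n (dot y v) + N.b2n (dot z v)).

(** The dual certificate with denominators cleared: after division by the total mass [s], this is a
    distribution on independent triples with average load at most 1 on each vector of [T]. *)
Definition is_packing (T : seq N) (L : seq triple) : bool :=
  [&& all (fun p : triple => let: (k, (x, y, z)) := p in
             [&& negb (N.eqb k 0) & indep3N x y z]) L,
      ~~ nilp L
    & let s := foldr (fun p : triple => N.add p.1) 0 L in
      all (fun v => N.leb (foldr (fun p => N.add (load v p)) 0 L) s) T].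

(* The machine keeps the list of patterns [X] already treated and a stack of
   open nodes [(X, C)], where [C] contains the vectors that may still occur
   besides [X]. [Fano x b] and [Embed x j b] remove [x] from [C] because
   [x :: X] then has a Fano minor, respectively a copy of the [j]-th treated
   pattern, in the basis [b]; [Close L] treats the top node by the
   distribution [L]. *)
Inductive step :=
| Branch of N
| Fano of N & seq N
| Embed of N & nat & seq N
| Close of seq triple.

Definition state := (seq (seq N) * seq (seq N * seq N))%type.

Definition prune (x : N) (s : seq N) : seq N :=
  [seq m <- s | negb (N.eqb x m)].

Definition run1 (st : state) (p : step) : option state :=
  let: (pats, stack) := st in
  if stack isn't (X, C) :: stack' then None else
  match p with
  (* The parent stays on the stack below its child. Once the child is closed its pattern counts as
     treated, and an [Embed] can remove [x] from the parent. *)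
  | Branch x => Some (pats, (x :: X, C) :: stack)
  | Fano x b =>
      if is_fano (x :: X) b then Some (pats, (X, prune x C) :: stack')
      else None
  | Embed x j b =>
      if (j < size pats)%nat && is_embedding (x :: X) (nth [::] pats j) b
      then Some (pats, (X, prune x C) :: stack') else None
  | Close L =>
      if is_packing (X ++ C) L then Some (rcons pats X, stack') else None
  end.

Fixpoint run (st : state) (p : seq step) : option state :=
  if p is s :: p' then
    if run1 st s is Some st' then run st' p' else None
  else Some st.

Definition verify (p : seq step) : bool :=
  if run ([::], [:: (std_basis, all_vectors)]) p is Some (pats, _) then
    (* The root is closed last, so its pattern must end the list; the default [[::]] fails the
       test. *)
    last [::] pats == std_basis
  else false.

End Checker.

(** * Coding of vectors and functionals by binary numbers *)

Lemma memNE m s : memN m s = (m \in s).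
Proof.
by apply/hasP/idP => [[k ks /N.eqb_eq->]|ms] //; exists m; rewrite // N.eqb_refl.
Qed.

Lemma vec_lxor a b : vec (N.lxor a b) = vec a + vec b.
Proof.
apply/matrixP => i j; rewrite !mxE N.lxor_spec.
by case: N.testbit; case: N.testbit.
Qed.

Definition basis_mx (b : seq N) : 'M[bool]_6 :=
  \matrix_(i, j) bit (nth 0%num b j) i.

Lemma bit_div2 m i : bit (N.div2 m) i = bit m i.+1.
Proof. by rewrite /bit Nat2N.inj_succ N.testbit_succ_r_div2 //; apply: N.le_0_l. Qed.

Lemma bit_comb b m i :
  bit (comb b m) i = \sum_(j < size b) bit (nth 0%num b j) i * bit m j.
Proof.
elim: b m => [|v b IHb] m; first by rewrite big_ord0 /bit N.bits_0.
rewrite big_ord_recl /=.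
under eq_bigr do rewrite -bit_div2; rewrite -IHb.
have -> : bit m 0 = N.odd m := N.bit0_odd m.
case: (N.odd m); last by rewrite [_ * false]mulr0 add0r.
rewrite [_ * true]mulr1 [LHS]N.lxor_spec.
by rewrite -/(bit v i) -/(bit (comb b _) i); case: bit; case: bit.
Qed.

Lemma vec_comb b m : size b = 6 -> vec (comb b m) = basis_mx b *m vec m.
Proof.
move=> sb; apply/matrixP => i j; rewrite !mxE.
have := bit_comb b m i; rewrite sb /bit => ->.
by apply: eq_bigr => k _; rewrite !mxE.
Qed.

Lemma vec_std_basis (i : 'I_6) : vec (nth 0%num std_basis i) = delta_mx i 0.
Proof.
apply/matrixP => k l; rewrite !mxE ord1 eqxx andbT.
by case: i k => [[|[|[|[|[|[|]]]]]]] ? // [[|[|[|[|[|[|]]]]]]] ?.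
Qed.

(** The combinations that produce the unit vectors are the columns of a right inverse. *)
Lemma basis_unit b : is_basis b -> basis_mx b \in unitmx.
Proof.
move=> /andP[/eqP sb /allP inS].
have /fin_all_exists[v Bv] (i : 'I_6) :
    exists v : 'cV_6, basis_mx b *m v = delta_mx i 0.
  have /inS : nth 0%num std_basis i \in std_basis by apply: mem_nth; case: i.
  rewrite memNE => /mapP[m _ eqm]; exists (vec m).
  by rewrite -vec_comb // -eqm vec_std_basis.
suff /mulmx1_unit[] : basis_mx b *m (\matrix_(i, j) v j i 0) = 1%:M by [].
apply/matrixP => i j; have /matrixP/(_ i 0) := Bv j.
by rewrite !mxE andbT eq_sym => <-; apply: eq_bigr => k _; rewrite !mxE.
Qed.

Lemma col_basis b j : col j (basis_mx b) = vec (nth 0%num b j).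
Proof. by apply/matrixP => i k; rewrite !mxE. Qed.

Lemma vec_surj (v : 'cV[bool]_6) : exists2 m, m \in all_vectors & v = vec m.
Proof.
have bits x0 x1 x2 x3 x4 x5 : has (fun m =>
    [seq bit m i | i <- iota 0 6] == [:: x0; x1; x2; x3; x4; x5]) all_vectors.
  by move: x0 x1 x2 x3 x4 x5; do 6!case.
have /hasP[m mA /eqP[b0 b1 b2 b3 b4 b5]] := bits (v (inord 0) 0)
  (v (inord 1) 0) (v (inord 2) 0) (v (inord 3) 0) (v (inord 4) 0) (v (inord 5) 0).
exists m => //; apply/matrixP => i j; rewrite mxE ord1 -[i in LHS]inord_val.
by case: i => [[|[|[|[|[|[|]]]]]]] i6 //=.
Qed.

Lemma dotE a b : ((vec a)^T *m vec b) 0 0 = dot a b.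
Proof.
rewrite mxE !big_ord_recl big_ord0 !mxE /dot /bit !N.land_spec.
by rewrite addr0.
Qed.

Lemma vec_neq0 m : nonzero m -> (vec m)^T != 0.
Proof.
move=> /hasP[i i6 bi]; apply/eqP => /matrixP.
have lti : (i < 6)%N by move: i6; rewrite !inE => /or4P[|||/or3P[]] /eqP ->.
by move=> /(_ 0 (Ordinal lti)); rewrite !mxE /= -/(bit m i) bi.
Qed.

Lemma indep3NP x y z : indep3N x y z -> indep3 (vec x)^T (vec y)^T (vec z)^T.
Proof.
rewrite /indep3N /= andbT => /and5P[nx ny nz nxy /and3P[nxz nyz nxyz]].
by rewrite /indep3 -!linearD /= -!vec_lxor !vec_neq0.
Qed.

(** * Soundness of the checker *)

Section Soundness.
Variables (R : realType) (E : finType).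
Implicit Types (c : E -> 'cV[bool]_6) (w : E -> R).
Local Notation light_triples := (@light_triples R E).
Local Notation forces_light := (@forces_light R E).

Lemma fano_sound c S b :
  fano_free c -> contains c S -> is_fano S b -> False.
Proof.
move=> ffc cS /and3P[bb /allP bS /allP pS].
have [sb _] := andP bb; have ub := basis_unit bb.
apply: (ffc _ ub) => [j|t tT].
  rewrite col_basis; apply: cS; rewrite -memNE; apply: bS.
  by apply: mem_nth; rewrite (eqP sb).
have [m mL mt] : exists2 m, m \in [:: 3; 5; 6; 7]%num &
    (bit m 0, bit m 1, bit m 2) = t.
  move: tT; rewrite !inE => /or4P[] /eqP ->.
  - by exists 3%num.
  - by exists 5%num.
  - by exists 6%num.
  - by exists 7%num.
have /hasP[k kL] := pS m mL; rewrite memNE => /cS[e he]; exists e.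
rewrite /coords he vec_comb ?(eqP sb) // mulKmx // -mt !mxE !inordK //.
(* Adding [8 * k] leaves the three lowest digits of [m] unchanged; the 32 cases are computed. *)
by move: mL kL; rewrite !inE => /or4P[] /eqP ->;
  do 7?[case/orP]; move/eqP ->.
Qed.

Lemma embedding_sound c S P b : fano_free c -> contains c S -> forces_light P ->
  is_embedding S P b -> light_triples c.
Proof.
move=> ffc cS pP /andP[bb /allP bS]; have [sb _] := andP bb.
apply: (forces_light_unit (basis_unit bb) ffc _ pP) => m mP.
have := bS m mP; rewrite memNE => /cS[e he]; exists e.
by rewrite he vec_comb // (eqP sb).
Qed.

Definition NtoR (n : N) : R := (N.to_nat n)%:R.

Lemma NtoRD a b : NtoR (a + b)%num = NtoR a + NtoR b.
Proof. by rewrite /NtoR N2Nat.inj_add -natrD. Qed.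

Lemma NtoRM a b : NtoR (a * b)%num = NtoR a * NtoR b.
Proof. by rewrite /NtoR N2Nat.inj_mul -natrM. Qed.

Lemma ler_NtoR a b : N.leb a b -> NtoR a <= NtoR b.
Proof. by move=> /N.leb_le; rewrite /NtoR ler_nat; lia. Qed.

Lemma NtoR_gt0 a : ~~ N.eqb a 0 -> 0 < NtoR a.
Proof. by move=> /N.eqb_spec a0; rewrite /NtoR ltr0n; lia. Qed.

(** The easy direction of duality: averaged over [L], the weight of a triple is the sum over [e] of
    [w e] times the average load at [c e], so it is at most the total weight, and some triple of [L]
    is at most average. *)
Lemma packing_sound c T L : (forall e, exists2 m, m \in T & c e = vec m) ->
  is_packing T L -> light_triples c.
Proof.
move=> /fin_all_exists2[v vT cE] /and3P[/allP indL Ln0 /allP leT] w w0.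
pose tr (p : triple) := let: (k, (x, y, z)) := p in
  \sum_(e in cocycle c (vec x)^T) w e + \sum_(e in cocycle c (vec y)^T) w e
      + \sum_(e in cocycle c (vec z)^T) w e.
have trE p : NtoR p.1 * tr p = \sum_e w e * NtoR (load (v e) p).
  case: p => k [[x y] z]; rewrite /tr /=.
  rewrite !(big_mkcond (fun e => e \in cocycle _ _)) /= -!big_split /= mulr_sumr.
  apply: eq_bigr => e _; rewrite NtoRM !NtoRD mulrCA; congr (_ * _).
  rewrite !inE cE !dotE.
  by do 3!case: (dot _ _); rewrite /NtoR /= ?mulrDr ?mulr1 ?mulr0.
have [/hasP[[k [[x y] z]] pL le]|/hasPn lt] :=
  boolP (has (fun p => tr p <= \sum_e w e) L).
  exists ((vec x)^T, (vec y)^T, (vec z)^T); split=> //=.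
  by apply: indep3NP; have /andP[] := indL _ pL.
exfalso.
have sumL (f : triple -> N) :
    NtoR (foldr (fun p => N.add (f p)) 0%num L) = \sum_(p <- L) NtoR (f p).
  elim: (L) => [|p l IHl]; first by rewrite big_nil.
  by rewrite big_cons -IHl /= NtoRD.
(* If every triple were too heavy, the inequality would stay strict after summation, since [L] is
   nonempty and its masses are positive. *)
have : \sum_(p <- L) NtoR p.1 * (\sum_e w e) < \sum_(p <- L) NtoR p.1 * tr p.
  rewrite big_seq [ltRHS]big_seq; apply: ltr_sum => [|p pL].
    by case: (L) Ln0 => //= p l _; rewrite inE eqxx.
  rewrite ltr_pM2l; first by rewrite ltNge lt.
  apply: NtoR_gt0.
  by case: p pL => k [[x y] z] /indL /andP[].
apply/negP; rewrite -leNgt -mulr_suml -sumL mulr_sumr.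
under eq_bigr do rewrite trE.
(* Exchanging the sums collects the total load at each element, which the packing bounds by the
   total mass. *)
rewrite exchange_big /=; apply: ler_sum => e _.
by rewrite -mulr_sumr -sumL [leRHS]mulrC ler_wpM2l // ler_NtoR // leT.
Qed.

(** The invariant of an open node: a configuration that contains [X] and leaves [X ++ C] has already
    been dealt with. *)
Definition settled (X C : seq N) : Prop := forall m, m \in all_vectors ->
  m \notin X ++ C -> forall c, fano_free c -> contains c (m :: X) -> light_triples c.

Definition sound (st : state) : Prop :=
  (forall X, X \in st.1 -> forces_light X) /\
  (forall p, p \in st.2 -> settled p.1 p.2).

Lemma settled_prune X C x :
  settled X C -> (forall c, fano_free c -> contains c (x :: X) -> light_triples c) ->
  settled X (prune x C).
Proof.
move=> sX gx m mA; have [->|/eqP mx] := eqVneq m x; first by [].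
rewrite mem_cat mem_filter => mX; apply: sX; rewrite // mem_cat.
case/norP: mX => mX; rewrite negb_or mX => /=.
by have /N.eqb_neq -> : x <> m by move=> ?; apply: mx.
Qed.

(** Either some column lies outside [X ++ C] and the invariant applies, or all columns lie inside
    and the packing does. *)
Lemma settled_close X C L : settled X C -> is_packing (X ++ C) L -> forces_light X.
Proof.
move=> sX pk c ffc cX.
have [/existsP[e /hasP[m mA /andP[mX /eqP ce]]]|no] := boolP
  [exists e, has (fun m => (m \notin X ++ C) && (c e == vec m)) all_vectors].
  apply: (sX m mA mX c ffc) => k; rewrite inE => /predU1P[->|/cX//].
  by exists e.
apply: (packing_sound _ pk) => e; have [m mA ce] := vec_surj (c e).
exists m => //; apply: contraNT no => mX; apply/existsP; exists e.
by apply/hasP; exists m => //; rewrite mX ce eqxx.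
Qed.

Lemma run1_sound st p st' : sound st -> run1 st p = Some st' -> sound st'.
Proof.
case: st => pats [|[X C] stack] //= [sp ss].
have sXC := ss (X, C) (mem_head _ _).
have sst q : q \in stack -> settled q.1 q.2.
  by move=> qs; apply: ss; rewrite inE qs orbT.
have top C' : settled X C' -> sound (pats, (X, C') :: stack).
  by move=> sC'; split=> // q; rewrite inE => /predU1P[->//|/sst].
case: p => [x|x b|x j b|L].
(* The child inherits the invariant with the same [C], because containing [m :: x :: X] implies
   containing [m :: X]. *)
- move=> [<-]; split=> // q; rewrite inE => /predU1P[->|/ss//] m mA.
  rewrite /= inE negb_or => /andP[_ mX] c ffc cX; apply: (sXC m mA mX c ffc) => k.
  rewrite inE => kX; apply: cX; rewrite !inE.
  by case/orP: kX => ->; rewrite ?orbT.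
- case: ifP => // fan [<-]; apply: top; apply: settled_prune sXC _ => c ffc cX.
  by case: (fano_sound ffc cX fan).
- case: ifP => // /andP[jp emb] [<-]; apply: top.
  apply: settled_prune sXC _ => c ffc cX.
  by apply: embedding_sound ffc cX _ emb; apply/sp/mem_nth.
- case: ifP => // pk [<-]; split=> // Y; rewrite mem_rcons inE => /predU1P[->|/sp//].
  exact: settled_close sXC pk.
Qed.

Lemma verify_sound p : verify p -> forces_light std_basis.
Proof.
rewrite /verify; set st0 := (_, _); have : sound st0.
  (* The root excludes nothing yet: its candidates are all 64 vectors, so its invariant is
     vacuous. *)
  split=> // q; rewrite inE => /eqP -> m mA.
  by rewrite mem_cat mA orbT.
elim: p st0 => [|s p IHp] st st_sound /=.
  case: st st_sound => pats stack [/= sp _] /eqP e; rewrite -e; apply: sp.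
  by case: pats e => //= P pats _; apply: mem_last.
case st1: (run1 st s) => [st'|] //; apply: IHp.
exact: run1_sound st_sound st1.
Qed.

End Soundness.

(** * The trace *)

(* The masses of the distributions are scaled to integers. *)
Definition certificate : seq step := (
  [:: Branch 51; Branch 15; Branch 29; Fano 3 [:: 1; 2; 8; 4; 32; 29];
      Fano 5 [:: 1; 2; 4; 8; 32; 51]; Fano 6 [:: 1; 2; 4; 8; 16; 32];
      Fano 7 [:: 1; 2; 8; 4; 32; 29]; Fano 9 [:: 1; 2; 8; 4; 32; 51];
      Fano 10 [:: 1; 2; 8; 4; 16; 32]; Fano 11 [:: 1; 2; 4; 8; 32; 29];
      Fano 13 [:: 1; 2; 8; 4; 32; 51]; Fano 14 [:: 1; 2; 8; 4; 16; 32];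
      Fano 17 [:: 1; 2; 16; 4; 32; 15]; Fano 18 [:: 1; 2; 16; 4; 8; 32];
      Fano 20 [:: 1; 4; 16; 2; 8; 32]; Fano 21 [:: 1; 2; 16; 4; 32; 15];
      Fano 22 [:: 2; 4; 16; 1; 8; 32]; Fano 23 [:: 2; 4; 16; 1; 8; 32];
      Fano 24 [:: 1; 8; 16; 2; 4; 32]; Fano 25 [:: 1; 2; 16; 8; 32; 15];
      Fano 26 [:: 2; 8; 16; 1; 4; 32]; Fano 27 [:: 2; 8; 16; 1; 4; 32];
      Fano 28 [:: 1; 8; 16; 2; 4; 32]; Fano 30 [:: 2; 8; 16; 1; 4; 32];
      Fano 31 [:: 2; 8; 16; 1; 4; 32]; Fano 33 [:: 1; 2; 16; 4; 8; 51];
      Fano 34 [:: 1; 2; 16; 4; 51; 15]; Fano 35 [:: 1; 2; 8; 4; 32; 29];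
      Fano 36 [:: 2; 4; 16; 1; 8; 51]; Fano 37 [:: 2; 4; 16; 1; 8; 51];
      Fano 38 [:: 1; 2; 16; 4; 51; 15]; Fano 39 [:: 1; 4; 16; 2; 8; 51];
      Fano 40 [:: 2; 8; 16; 1; 4; 51]; Fano 41 [:: 2; 8; 16; 1; 4; 51];
      Fano 42 [:: 1; 2; 8; 4; 16; 32]; Fano 43 [:: 1; 8; 16; 2; 4; 51];
      Fano 44 [:: 2; 8; 16; 1; 4; 51]; Fano 45 [:: 2; 8; 16; 1; 4; 51];
      Fano 46 [:: 1; 2; 8; 4; 16; 32]; Fano 47 [:: 1; 8; 16; 2; 4; 51];
      Fano 48 [:: 1; 2; 8; 4; 51; 29]; Fano 49 [:: 1; 2; 16; 4; 32; 15];
      Fano 50 [:: 1; 2; 16; 4; 8; 32]; Fano 52 [:: 1; 4; 16; 2; 8; 32];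
      Fano 53 [:: 1; 2; 16; 4; 32; 15]; Fano 54 [:: 2; 4; 16; 1; 8; 32];
      Fano 55 [:: 2; 4; 16; 1; 8; 32]; Fano 56 [:: 1; 8; 16; 2; 4; 32];
      Fano 57 [:: 1; 2; 8; 4; 16; 51]; Fano 58 [:: 2; 8; 16; 1; 4; 32];
      Fano 59 [:: 2; 8; 16; 1; 4; 32]; Fano 60 [:: 1; 8; 16; 2; 4; 32];
      Fano 61 [:: 1; 2; 8; 4; 16; 51]; Fano 62 [:: 2; 8; 16; 1; 4; 32];
      Fano 63 [:: 2; 8; 16; 1; 4; 32];
      Close [:: (5, (12, 22, 34)); (10, (3, 32, 17)); (6, (12, 32, 16)); (2,
        (3, 4, 8))]; Embed 21 0 [:: 2; 1; 32; 51; 4; 8];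
      Embed 22 0 [:: 1; 2; 32; 51; 4; 8]; Embed 25 0 [:: 2; 1; 32; 51; 8; 4];
      Embed 26 0 [:: 1; 2; 32; 51; 8; 4]; Embed 29 0 [:: 1; 2; 32; 51; 15; 4];
      Embed 30 0 [:: 2; 1; 32; 51; 15; 4]; Embed 37 0 [:: 2; 1; 16; 51; 4; 8];
      Embed 38 0 [:: 1; 2; 16; 51; 4; 8]; Embed 41 0 [:: 2; 1; 16; 51; 8; 4];
      Embed 42 0 [:: 1; 2; 16; 51; 8; 4]; Embed 45 0 [:: 1; 2; 16; 51; 15; 4];
      Embed 46 0 [:: 2; 1; 16; 51; 15; 4]; Embed 53 0 [:: 1; 2; 16; 32; 4; 8];
      Embed 54 0 [:: 2; 1; 16; 32; 4; 8]; Embed 57 0 [:: 1; 2; 16; 32; 8; 4];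
      Embed 58 0 [:: 2; 1; 16; 32; 8; 4]; Embed 61 0 [:: 2; 1; 16; 32; 15; 4];
      Embed 62 0 [:: 1; 2; 16; 32; 15; 4]; Branch 63;
      Fano 20 [:: 2; 4; 16; 1; 8; 32]; Fano 24 [:: 2; 8; 16; 1; 4; 32];
      Fano 28 [:: 2; 8; 16; 1; 4; 32]; Fano 36 [:: 2; 4; 32; 1; 8; 16];
      Fano 40 [:: 2; 8; 32; 1; 4; 16]; Fano 44 [:: 2; 8; 32; 1; 4; 16];
      Fano 52 [:: 2; 4; 32; 1; 8; 16]; Fano 56 [:: 2; 8; 32; 1; 4; 16];
      Fano 60 [:: 2; 8; 32; 1; 4; 16]; Branch 23;
      Fano 9 [:: 32; 4; 8; 2; 16; 51]; Fano 10 [:: 32; 4; 8; 1; 16; 51];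
      Fano 11 [:: 32; 4; 8; 1; 16; 51]; Fano 27 [:: 4; 8; 51; 1; 2; 32];
      Fano 33 [:: 8; 16; 32; 2; 4; 15]; Fano 34 [:: 8; 16; 32; 1; 4; 15];
      Fano 35 [:: 8; 16; 32; 1; 4; 15]; Fano 39 [:: 15; 16; 32; 1; 2; 8];
      Fano 47 [:: 15; 16; 32; 1; 2; 8]; Fano 59 [:: 4; 8; 51; 1; 2; 32];
      Branch 43; Fano 5 [:: 16; 23; 8; 2; 32; 51];
      Fano 6 [:: 16; 23; 8; 1; 32; 51]; Fano 7 [:: 16; 23; 8; 1; 32; 51];
      Fano 12 [:: 51; 4; 8; 1; 16; 32]; Fano 13 [:: 51; 4; 8; 1; 16; 32];
      Fano 14 [:: 51; 4; 8; 2; 16; 32]; Fano 17 [:: 4; 23; 32; 2; 8; 15];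
      Fano 18 [:: 4; 23; 32; 1; 8; 15]; Fano 19 [:: 4; 23; 32; 1; 8; 15];
      Fano 31 [:: 15; 23; 32; 1; 2; 4]; Fano 48 [:: 15; 16; 32; 1; 4; 8];
      Fano 49 [:: 15; 16; 32; 1; 4; 8]; Fano 50 [:: 15; 16; 32; 2; 4; 8];
      Fano 55 [:: 23; 8; 51; 1; 2; 16];
      Close [:: (209, (40, 34, 32)); (77, (33, 25, 60)); (327, (26, 38, 3));
        (180, (60, 12, 20)); (436, (3, 5, 8)); (110, (48, 18, 40)); (11, (4,
        56, 8)); (27, (32, 48, 8)); (273, (4, 48, 20)); (91, (33, 48, 12));
        (292, (3, 9, 16))]; Embed 43 1 [:: 1; 2; 32; 8; 16; 4];
      Close [:: (2, (48, 32, 8)); (1, (17, 12, 23)); (1, (12, 32, 3)); (1, (23,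
        8, 5)); (1, (48, 3, 12))]; Embed 23 2 [:: 1; 2; 16; 32; 4; 8];
      Embed 27 2 [:: 1; 2; 16; 32; 8; 4]; Embed 39 2 [:: 1; 2; 32; 16; 4; 8];
      Embed 43 2 [:: 1; 2; 32; 16; 8; 4]; Branch 34;
      Fano 18 [:: 8; 16; 32; 1; 4; 15]; Fano 19 [:: 8; 16; 32; 1; 4; 15];
      Fano 33 [:: 1; 2; 32; 4; 8; 16]; Fano 49 [:: 1; 2; 32; 4; 8; 16];
      Branch 11; Fano 5 [:: 34; 4; 8; 2; 16; 51];
      Fano 6 [:: 32; 4; 8; 1; 16; 51]; Fano 7 [:: 32; 4; 8; 1; 16; 51];
      Fano 14 [:: 1; 2; 51; 8; 16; 63]; Embed 13 2 [:: 32; 11; 4; 63; 34; 1];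
      Branch 47; Fano 31 [:: 11; 16; 34; 1; 2; 4];
      Embed 48 2 [:: 4; 47; 16; 48; 8; 1]; Branch 9;
      Fano 10 [:: 1; 34; 8; 4; 16; 32]; Embed 3 2 [:: 4; 63; 16; 32; 9; 1];
      Close [:: (1, (4, 34, 3)); (1, (48, 12, 25))];
      Embed 9 3 [:: 16; 32; 4; 63; 1; 2]; Embed 50 3 [:: 4; 47; 2; 11; 51; 16];
      Embed 59 3 [:: 2; 15; 16; 34; 8; 4];
      Close [:: (1, (3, 16, 36)); (1, (17, 42, 16)); (1, (36, 42, 12)); (1,
        (12, 3, 17))]; Embed 9 4 [:: 16; 32; 4; 63; 1; 2];
      Embed 47 4 [:: 1; 2; 4; 8; 16; 32];
      Close [:: (1, (4, 17, 42)); (1, (3, 4, 48)); (1, (17, 12, 48)); (1, (3,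
        12, 42))]; Embed 5 5 [:: 8; 5; 32; 15; 51; 1];
      Embed 7 5 [:: 16; 32; 8; 63; 1; 2]; Embed 9 5 [:: 4; 9; 32; 15; 51; 1];
      Embed 11 5 [:: 16; 32; 4; 63; 1; 2]; Branch 3;
      Fano 6 [:: 1; 2; 51; 8; 16; 63]; Fano 10 [:: 1; 2; 51; 4; 16; 63];
      Fano 14 [:: 1; 2; 51; 4; 16; 63];
      Close [:: (1, (3, 34, 12)); (1, (12, 48, 17))];
      Embed 3 6 [:: 1; 2; 4; 8; 16; 32]; Embed 13 6 [:: 15; 2; 4; 8; 16; 34];
      Branch 50; Fano 17 [:: 1; 34; 16; 4; 8; 32];
      Embed 14 6 [:: 32; 34; 4; 8; 15; 50]; Embed 35 2 [:: 4; 8; 63; 16; 1; 2];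
      Branch 55; Fano 59 [:: 4; 8; 50; 1; 2; 16];
      Embed 6 5 [:: 16; 32; 8; 15; 51; 2]; Embed 10 5 [:: 16; 34; 4; 1; 63; 2];
      Embed 12 6 [:: 16; 34; 4; 55; 15; 2];
      Close [:: (138, (34, 17, 5)); (130, (48, 16, 6)); (67, (42, 34, 3)); (23,
        (32, 52, 3)); (3, (50, 59, 56)); (7, (48, 35, 18)); (64, (12, 16, 38));
        (13, (12, 48, 3)); (6, (52, 55, 4)); (5, (6, 8, 18)); (105, (3, 5, 9));
        (150, (56, 8, 12))]; Embed 55 7 [:: 1; 2; 4; 8; 16; 32];
      Embed 59 7 [:: 1; 2; 8; 4; 16; 32]; Branch 31;
      Fano 47 [:: 15; 16; 34; 1; 2; 4]; Fano 48 [:: 15; 16; 32; 1; 4; 8];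
      Embed 6 5 [:: 8; 6; 16; 1; 63; 2]; Embed 10 5 [:: 4; 10; 16; 1; 63; 2];
      Close [:: (35, (3, 4, 8)); (78, (12, 34, 17)); (20, (53, 57, 48)); (87,
        (12, 18, 32)); (3, (27, 19, 3)); (1, (36, 20, 23)); (9, (33, 37, 41));
        (21, (3, 5, 9)); (75, (12, 16, 35))];
      Embed 31 8 [:: 1; 2; 4; 8; 16; 32];
      Close [:: (1, (3, 4, 8)); (1, (3, 5, 9)); (1, (12, 4, 5)); (2, (34, 46,
        16)); (1, (48, 1, 34)); (1, (48, 8, 9)); (3, (15, 48, 16))];
      Embed 48 9 [:: 15; 2; 4; 8; 16; 34]; Embed 50 9 [:: 1; 2; 4; 8; 16; 32];
      Branch 31; Fano 47 [:: 15; 16; 34; 1; 2; 4];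
      Embed 6 5 [:: 8; 6; 16; 1; 63; 2]; Embed 10 5 [:: 4; 10; 16; 1; 63; 2];
      Embed 14 6 [:: 1; 15; 4; 8; 34; 31];
      Close [:: (21, (3, 12, 17)); (6, (48, 3, 42)); (1, (17, 28, 42)); (3,
        (28, 44, 4)); (4, (16, 48, 4)); (5, (34, 12, 38)); (4, (12, 16, 32));
        (5, (8, 34, 17)); (5, (48, 34, 44))];
      Embed 17 10 [:: 15; 2; 4; 8; 16; 34];
      Embed 31 10 [:: 1; 2; 4; 8; 16; 32]; Branch 55;
      Fano 59 [:: 4; 8; 34; 1; 2; 16]; Embed 6 5 [:: 16; 32; 8; 15; 51; 2];
      Embed 10 5 [:: 16; 34; 4; 1; 63; 2];
      Close [:: (69, (28, 6, 34)); (212, (33, 16, 28)); (88, (33, 10, 12));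
        (202, (42, 34, 3)); (362, (3, 48, 17)); (31, (32, 36, 34)); (19, (40,
        24, 12)); (239, (12, 16, 38)); (260, (12, 8, 5)); (11, (16, 2, 10))];
      Embed 55 11 [:: 1; 2; 4; 8; 16; 32]; Embed 59 11 [:: 1; 2; 8; 4; 16; 32];
      Close [:: (1, (9, 48, 34)); (14, (16, 46, 42)); (7, (16, 33, 32)); (6,
        (8, 16, 38)); (3, (16, 17, 5)); (1, (48, 4, 34)); (5, (48, 38, 15));
        (3, (5, 34, 38)); (14, (3, 12, 16)); (32, (12, 17, 33)); (14, (6, 10,
        16))]; Embed 5 12 [:: 2; 1; 16; 32; 8; 4];
      Embed 6 12 [:: 1; 2; 16; 32; 8; 4]; Embed 9 12 [:: 2; 1; 16; 32; 4; 8];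
      Embed 10 12 [:: 1; 2; 16; 32; 4; 8]; Embed 17 12 [:: 2; 1; 4; 8; 32; 16];
      Embed 18 12 [:: 1; 2; 4; 8; 32; 16]; Embed 33 12 [:: 2; 1; 4; 8; 16; 32];
      Embed 34 12 [:: 1; 2; 4; 8; 16; 32]; Close [:: (1, (12, 3, 48))];
      Embed 23 13 [:: 1; 2; 32; 51; 15; 8];
      Embed 27 13 [:: 1; 2; 32; 51; 15; 4];
      Embed 28 13 [:: 1; 2; 32; 51; 8; 4];
      Embed 39 13 [:: 1; 2; 16; 51; 15; 8];
      Embed 43 13 [:: 1; 2; 16; 51; 15; 4];
      Embed 44 13 [:: 1; 2; 16; 51; 8; 4];
      Embed 52 13 [:: 1; 2; 16; 32; 15; 8];
      Embed 56 13 [:: 1; 2; 16; 32; 15; 4];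
      Embed 63 13 [:: 1; 2; 16; 32; 8; 4]; Branch 47;
      Fano 31 [:: 2; 8; 16; 1; 4; 51]; Fano 36 [:: 2; 4; 32; 1; 8; 16];
      Fano 40 [:: 2; 8; 32; 1; 4; 16]; Fano 60 [:: 2; 8; 32; 1; 4; 16];
      Embed 7 13 [:: 16; 51; 8; 47; 2; 1];
      Embed 11 13 [:: 16; 51; 4; 47; 2; 1];
      Embed 13 13 [:: 16; 51; 4; 8; 32; 2];
      Embed 14 13 [:: 16; 51; 4; 8; 32; 1];
      Embed 19 13 [:: 4; 8; 51; 47; 2; 1];
      Embed 33 13 [:: 4; 8; 16; 51; 15; 1];
      Embed 34 13 [:: 4; 8; 16; 51; 15; 2];
      Embed 48 13 [:: 4; 8; 16; 47; 2; 1]; Branch 17;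
      Fano 18 [:: 1; 2; 16; 4; 8; 32]; Fano 50 [:: 15; 16; 32; 2; 4; 8];
      Embed 3 13 [:: 51; 47; 4; 8; 17; 2]; Embed 5 11 [:: 8; 47; 4; 16; 2; 32];
      Embed 9 11 [:: 4; 47; 8; 16; 2; 32];
      Embed 20 11 [:: 8; 15; 4; 1; 51; 32];
      Embed 24 11 [:: 4; 15; 8; 1; 51; 32];
      Embed 35 13 [:: 2; 15; 51; 17; 8; 4];
      Close [:: (1, (17, 10, 12)); (1, (48, 33, 6))];
      Embed 5 14 [:: 1; 2; 16; 51; 4; 15]; Embed 6 14 [:: 2; 1; 16; 51; 4; 15];
      Embed 9 14 [:: 1; 2; 16; 51; 8; 15];
      Embed 10 14 [:: 2; 1; 16; 51; 8; 15];
      Embed 17 14 [:: 1; 2; 4; 8; 16; 32]; Embed 18 14 [:: 2; 1; 4; 8; 16; 32];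
      Embed 20 14 [:: 16; 51; 1; 2; 4; 47];
      Embed 24 14 [:: 16; 51; 1; 2; 8; 47];
      Embed 49 14 [:: 2; 1; 4; 8; 51; 32]; Embed 50 14 [:: 1; 2; 4; 8; 51; 32];
      Embed 55 14 [:: 51; 16; 1; 2; 4; 47];
      Embed 59 14 [:: 51; 16; 1; 2; 8; 47];
      Close [:: (3, (3, 4, 8)); (2, (48, 1, 16)); (6, (12, 16, 34)); (1, (12,
        48, 21)); (1, (3, 51, 22)); (2, (3, 5, 9))];
      Embed 20 15 [:: 1; 2; 32; 51; 8; 4]; Embed 24 15 [:: 1; 2; 32; 51; 4; 8];
      Embed 31 15 [:: 1; 2; 4; 8; 32; 16]; Embed 36 15 [:: 1; 2; 16; 51; 8; 4];
      Embed 40 15 [:: 1; 2; 16; 51; 4; 8]; Embed 47 15 [:: 1; 2; 4; 8; 16; 32];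
      Embed 55 15 [:: 1; 2; 16; 32; 8; 4]; Embed 59 15 [:: 1; 2; 16; 32; 4; 8];
      Embed 60 15 [:: 1; 2; 4; 8; 16; 51];
      Close [:: (1, (48, 4, 16)); (1, (8, 12, 16)); (1, (32, 8, 48)); (1, (12,
        4, 32))]; Embed 15 16 [:: 1; 2; 16; 32; 8; 4];
      Embed 29 16 [:: 1; 16; 4; 8; 32; 2]; Embed 30 16 [:: 2; 16; 4; 8; 32; 1];
      Embed 31 16 [:: 32; 51; 4; 8; 2; 1]; Embed 45 16 [:: 1; 32; 4; 8; 16; 2];
      Embed 46 16 [:: 2; 32; 4; 8; 16; 1]; Embed 47 16 [:: 16; 51; 4; 8; 2; 1];
      Embed 60 16 [:: 16; 32; 4; 8; 2; 1]; Embed 61 16 [:: 2; 51; 4; 8; 16; 1];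
      Embed 62 16 [:: 1; 51; 4; 8; 16; 2]; Branch 37;
      Embed 9 16 [:: 4; 37; 8; 32; 16; 2];
      Embed 11 13 [:: 16; 51; 8; 11; 37; 4];
      Embed 12 16 [:: 1; 32; 8; 37; 16; 2];
      Embed 14 13 [:: 16; 51; 8; 14; 32; 1];
      Embed 25 13 [:: 2; 51; 8; 25; 37; 4];
      Embed 27 13 [:: 2; 16; 8; 27; 37; 4];
      Embed 28 13 [:: 2; 51; 8; 28; 32; 1];
      Embed 40 16 [:: 4; 37; 2; 16; 8; 1];
      Embed 42 13 [:: 16; 51; 8; 42; 37; 4];
      Embed 56 13 [:: 2; 51; 8; 56; 37; 4];
      Embed 58 13 [:: 2; 16; 8; 58; 37; 4];
      Embed 63 13 [:: 2; 16; 8; 63; 32; 1]; Branch 54;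
      Fano 3 [:: 1; 2; 32; 4; 8; 16]; Fano 5 [:: 1; 4; 32; 2; 8; 16];
      Fano 6 [:: 2; 4; 32; 1; 8; 16]; Fano 7 [:: 2; 4; 32; 1; 8; 16];
      Fano 13 [:: 1; 4; 32; 2; 8; 16]; Fano 17 [:: 1; 16; 32; 2; 4; 8];
      Fano 19 [:: 1; 16; 32; 2; 4; 8]; Fano 20 [:: 4; 16; 32; 1; 2; 8];
      Fano 21 [:: 4; 16; 32; 1; 2; 8]; Fano 22 [:: 4; 16; 32; 1; 2; 8];
      Fano 23 [:: 4; 16; 32; 1; 2; 8]; Fano 33 [:: 1; 4; 16; 2; 8; 54];
      Fano 34 [:: 1; 2; 4; 8; 16; 37]; Fano 35 [:: 1; 4; 16; 2; 8; 54];
      Fano 36 [:: 1; 4; 16; 2; 8; 51]; Fano 38 [:: 1; 4; 16; 2; 8; 51];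
      Fano 39 [:: 1; 2; 4; 8; 16; 32]; Fano 41 [:: 1; 4; 16; 2; 8; 54];
      Fano 43 [:: 1; 4; 16; 2; 8; 54]; Fano 44 [:: 1; 4; 16; 2; 8; 51];
      Fano 48 [:: 1; 4; 16; 2; 8; 37]; Fano 49 [:: 1; 2; 4; 8; 16; 54];
      Fano 50 [:: 1; 4; 16; 2; 8; 37]; Fano 52 [:: 1; 2; 4; 8; 16; 51];
      Fano 53 [:: 1; 4; 16; 2; 8; 32]; Fano 55 [:: 1; 4; 16; 2; 8; 32];
      Fano 57 [:: 1; 2; 4; 8; 16; 54]; Embed 59 0 [:: 54; 1; 8; 59; 37; 2];
      Close [:: (71, (26, 1, 29)); (26, (8, 56, 34)); (113, (36, 33, 37)); (95,
        (1, 18, 33)); (126, (18, 36, 42)); (21, (1, 8, 20)); (29, (8, 29, 18));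
        (135, (26, 16, 4)); (78, (2, 5, 8)); (52, (3, 4, 8))];
      Embed 7 17 [:: 2; 16; 7; 8; 51; 1]; Embed 21 17 [:: 16; 2; 21; 8; 51; 1];
      Embed 23 17 [:: 4; 2; 32; 8; 16; 1];
      Embed 38 17 [:: 2; 16; 38; 8; 51; 1];
      Embed 52 17 [:: 4; 2; 32; 8; 51; 1];
      Embed 54 17 [:: 32; 2; 37; 8; 16; 1]; Branch 57;
      Fano 13 [:: 1; 4; 32; 2; 16; 13]; Fano 44 [:: 1; 4; 8; 2; 16; 44];
      Embed 3 13 [:: 8; 57; 51; 3; 37; 4]; Embed 6 13 [:: 8; 57; 51; 6; 32; 1];
      Embed 19 13 [:: 4; 37; 8; 57; 19; 1];
      Embed 22 13 [:: 8; 57; 2; 22; 32; 1];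
      Embed 26 17 [:: 16; 1; 26; 4; 32; 2];
      Embed 34 13 [:: 4; 37; 8; 57; 34; 1];
      Embed 39 13 [:: 8; 57; 51; 39; 32; 1];
      Embed 43 17 [:: 8; 1; 51; 4; 32; 2];
      Embed 50 13 [:: 8; 57; 4; 37; 50; 2];
      Embed 55 13 [:: 8; 57; 2; 55; 32; 1];
      Close [:: (1, (33, 2, 4)); (1, (37, 8, 10))];
      Embed 26 18 [:: 32; 2; 4; 8; 51; 1]; Embed 43 18 [:: 32; 8; 4; 16; 2; 1];
      Embed 57 18 [:: 32; 2; 4; 8; 16; 1]; Branch 44;
      Fano 5 [:: 1; 4; 32; 2; 8; 16]; Fano 10 [:: 1; 2; 4; 16; 51; 44];
      Fano 13 [:: 1; 4; 32; 2; 8; 16]; Fano 24 [:: 1; 4; 8; 2; 51; 44];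
      Fano 41 [:: 1; 4; 8; 2; 16; 44]; Fano 59 [:: 1; 4; 8; 2; 16; 44];
      Embed 3 13 [:: 2; 37; 16; 51; 44; 8];
      Embed 6 13 [:: 2; 32; 16; 51; 44; 8];
      Embed 17 13 [:: 16; 37; 8; 44; 51; 2];
      Embed 19 13 [:: 4; 51; 8; 44; 16; 2];
      Embed 20 13 [:: 16; 32; 8; 44; 51; 2];
      Embed 22 13 [:: 1; 51; 8; 44; 16; 2];
      Embed 34 13 [:: 2; 4; 16; 51; 44; 8];
      Embed 39 13 [:: 1; 2; 16; 51; 44; 8];
      Embed 48 13 [:: 4; 16; 8; 44; 51; 2];
      Embed 50 13 [:: 51; 37; 8; 44; 16; 2];
      Embed 53 13 [:: 1; 16; 8; 44; 51; 2];
      Embed 55 13 [:: 32; 51; 8; 44; 16; 2];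
      Close [:: (27, (31, 41, 2)); (1, (47, 63, 6)); (26, (41, 8, 17)); (29,
        (18, 16, 17)); (20, (33, 54, 37)); (43, (18, 36, 8)); (32, (52, 12,
        16)); (73, (3, 4, 8)); (12, (2, 5, 8)); (6, (1, 2, 4))];
      Embed 13 19 [:: 32; 2; 4; 8; 16; 1];
      Embed 44 19 [:: 32; 2; 37; 8; 16; 1]; Branch 5;
      Fano 36 [:: 1; 4; 32; 2; 8; 16]; Embed 41 16 [:: 8; 41; 2; 16; 37; 1];
      Branch 10; Embed 3 16 [:: 5; 3; 16; 51; 8; 4];
      Embed 6 16 [:: 5; 6; 16; 32; 8; 1];
      Embed 17 16 [:: 32; 17; 8; 51; 16; 4];
      Embed 19 16 [:: 1; 19; 8; 16; 51; 4];
      Embed 20 16 [:: 37; 20; 8; 51; 16; 1];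
      Embed 22 16 [:: 4; 22; 8; 16; 32; 1];
      Embed 24 18 [:: 32; 2; 4; 10; 51; 1];
      Embed 34 16 [:: 5; 34; 8; 37; 16; 4];
      Embed 39 16 [:: 5; 39; 8; 32; 16; 1];
      Embed 48 16 [:: 1; 48; 8; 51; 16; 4];
      Embed 50 16 [:: 32; 50; 8; 16; 51; 4];
      Embed 53 16 [:: 4; 53; 8; 51; 16; 1];
      Embed 55 16 [:: 37; 55; 8; 16; 32; 1];
      Embed 59 18 [:: 32; 2; 4; 10; 16; 1];
      Close [:: (7, (4, 48, 16)); (1, (26, 8, 42)); (3, (3, 4, 8)); (4, (33,
        26, 62)); (5, (37, 33, 8)); (7, (2, 5, 8))];
      Embed 10 20 [:: 32; 2; 37; 8; 16; 1];
      Embed 24 20 [:: 32; 16; 37; 8; 2; 1];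
      Embed 59 20 [:: 32; 51; 37; 8; 2; 1];
      Close [:: (12, (8, 20, 33)); (8, (1, 6, 8)); (10, (8, 5, 1)); (14, (8,
        53, 19)); (15, (8, 55, 48)); (12, (8, 49, 33)); (15, (8, 18, 52)); (22,
        (8, 33, 7)); (7, (8, 21, 34)); (5, (8, 32, 51)); (15, (8, 34, 17)); (8,
        (8, 21, 35)); (14, (8, 53, 2)); (14, (8, 39, 50)); (14, (8, 23, 54));
        (28, (4, 8, 16)); (18, (8, 4, 36)); (5, (8, 22, 32))];
      Embed 5 21 [:: 32; 2; 37; 8; 16; 1]; Embed 36 21 [:: 32; 2; 4; 8; 16; 1];
      Close [:: (1, (4, 33, 8))]; Embed 7 22 [:: 2; 16; 4; 8; 32; 1];
      Embed 11 22 [:: 2; 16; 8; 4; 32; 1]; Embed 21 22 [:: 16; 2; 4; 8; 32; 1];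
      Embed 22 22 [:: 16; 1; 4; 8; 32; 2]; Embed 23 22 [:: 23; 1; 32; 8; 2; 4];
      Embed 25 22 [:: 16; 2; 8; 4; 32; 1]; Embed 26 22 [:: 16; 1; 8; 4; 32; 2];
      Embed 27 22 [:: 27; 1; 32; 4; 2; 8]; Embed 37 22 [:: 32; 2; 4; 8; 16; 1];
      Embed 38 22 [:: 32; 1; 4; 8; 16; 2]; Embed 39 22 [:: 39; 1; 16; 8; 2; 4];
      Embed 41 22 [:: 32; 2; 8; 4; 16; 1]; Embed 42 22 [:: 32; 1; 8; 4; 16; 2];
      Embed 43 22 [:: 43; 1; 16; 4; 2; 8]; Embed 52 22 [:: 52; 1; 16; 8; 2; 4];
      Embed 53 22 [:: 51; 1; 4; 8; 16; 2]; Embed 54 22 [:: 51; 2; 4; 8; 16; 1];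
      Embed 56 22 [:: 56; 1; 16; 4; 2; 8]; Embed 57 22 [:: 51; 1; 8; 4; 16; 2];
      Embed 58 22 [:: 51; 2; 8; 4; 16; 1]; Branch 17; Branch 33;
      Fano 3 [:: 1; 2; 16; 4; 8; 51]; Fano 48 [:: 1; 16; 32; 2; 4; 8];
      Fano 50 [:: 1; 16; 32; 2; 4; 8]; Embed 6 21 [:: 33; 4; 32; 8; 51; 16];
      Embed 10 21 [:: 33; 8; 32; 4; 51; 16];
      Embed 13 19 [:: 17; 4; 33; 2; 8; 16];
      Embed 20 22 [:: 17; 2; 4; 8; 51; 1]; Embed 24 22 [:: 17; 2; 8; 4; 51; 1];
      Embed 28 16 [:: 1; 17; 4; 8; 51; 2]; Embed 36 22 [:: 33; 2; 4; 8; 51; 1];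
      Embed 40 22 [:: 33; 2; 8; 4; 51; 1]; Embed 44 16 [:: 1; 33; 4; 8; 51; 2];
      Embed 55 21 [:: 33; 2; 32; 8; 4; 16];
      Embed 59 21 [:: 33; 2; 32; 4; 8; 16]; Branch 19;
      Fano 34 [:: 17; 2; 32; 4; 8; 16]; Embed 5 22 [:: 16; 4; 51; 8; 19; 2];
      Embed 9 22 [:: 16; 8; 51; 4; 19; 2];
      Embed 14 16 [:: 17; 19; 16; 51; 8; 4];
      Embed 63 16 [:: 32; 19; 4; 8; 16; 2];
      Close [:: (9, (3, 4, 8)); (5, (12, 17, 32)); (4, (12, 18, 33)); (1, (2,
        17, 33)); (2, (1, 2, 4)); (2, (2, 16, 8))];
      Embed 18 23 [:: 16; 51; 4; 8; 2; 1]; Embed 19 23 [:: 32; 2; 4; 8; 51; 1];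
      Embed 34 23 [:: 32; 51; 4; 8; 2; 1]; Embed 35 23 [:: 16; 2; 4; 8; 51; 1];
      Close [:: (4, (6, 2, 32)); (2, (10, 18, 45)); (3, (6, 10, 17)); (6, (33,
        18, 4)); (5, (29, 45, 12)); (1, (29, 8, 18)); (5, (34, 8, 32)); (4,
        (48, 16, 17)); (1, (8, 16, 10))]; Embed 3 24 [:: 1; 32; 4; 8; 16; 2];
      Embed 18 24 [:: 16; 32; 4; 8; 2; 1]; Embed 33 24 [:: 1; 2; 4; 8; 32; 16];
      Embed 35 24 [:: 16; 2; 4; 8; 51; 1]; Embed 48 24 [:: 16; 2; 4; 8; 32; 1];
      Embed 50 24 [:: 1; 2; 4; 8; 51; 16]; Branch 63;
      Embed 5 16 [:: 1; 51; 8; 63; 16; 2]; Embed 6 16 [:: 2; 51; 8; 63; 16; 1];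
      Embed 9 16 [:: 1; 51; 4; 63; 16; 2];
      Embed 10 16 [:: 2; 51; 4; 63; 16; 1];
      Embed 13 13 [:: 16; 13; 4; 8; 32; 2];
      Embed 14 19 [:: 51; 1; 14; 4; 16; 2];
      Embed 20 16 [:: 16; 51; 8; 63; 2; 1];
      Embed 24 16 [:: 16; 51; 4; 63; 2; 1];
      Embed 28 13 [:: 1; 28; 4; 8; 32; 2];
      Embed 36 16 [:: 32; 51; 8; 63; 2; 1];
      Embed 40 16 [:: 32; 51; 4; 63; 2; 1];
      Embed 44 19 [:: 51; 1; 44; 4; 2; 32];
      Close [:: (39, (3, 8, 17)); (1, (34, 5, 9)); (7, (34, 16, 48)); (36, (12,
        48, 4)); (11, (10, 34, 17)); (9, (13, 34, 4))];
      Embed 14 25 [:: 1; 51; 4; 8; 16; 32];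
      Embed 44 25 [:: 1; 51; 4; 8; 16; 2]; Embed 63 25 [:: 1; 32; 4; 8; 16; 2];
      Branch 20; Embed 5 21 [:: 16; 2; 20; 8; 32; 1];
      Embed 6 21 [:: 20; 32; 4; 8; 51; 1]; Embed 9 25 [:: 4; 9; 2; 32; 20; 8];
      Embed 10 25 [:: 8; 51; 1; 4; 10; 32];
      Embed 12 25 [:: 8; 20; 2; 32; 12; 1];
      Embed 13 16 [:: 1; 16; 8; 20; 32; 2];
      Embed 28 25 [:: 8; 4; 2; 32; 28; 1]; Embed 36 21 [:: 20; 2; 4; 8; 51; 1];
      Embed 40 25 [:: 8; 51; 1; 4; 40; 2]; Embed 55 21 [:: 20; 2; 4; 8; 32; 1];
      Embed 59 25 [:: 8; 32; 1; 4; 59; 2];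
      Close [:: (1, (2, 4, 8)); (1, (1, 4, 8)); (1, (1, 2, 8)); (3, (3, 4, 8));
        (1, (1, 2, 4))]; Embed 5 26 [:: 16; 32; 4; 8; 1; 2];
      Embed 9 26 [:: 16; 32; 8; 4; 1; 2]; Embed 20 26 [:: 1; 32; 4; 8; 16; 2];
      Embed 24 26 [:: 1; 32; 8; 4; 16; 2]; Branch 34;
      Embed 6 26 [:: 32; 16; 4; 8; 2; 1]; Embed 10 26 [:: 32; 16; 8; 4; 2; 1];
      Embed 13 25 [:: 2; 51; 4; 8; 32; 16];
      Embed 19 24 [:: 32; 1; 4; 8; 51; 2]; Embed 28 25 [:: 2; 51; 4; 8; 32; 1];
      Embed 36 26 [:: 2; 16; 4; 8; 32; 1]; Embed 40 26 [:: 2; 16; 8; 4; 32; 1];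
      Embed 49 24 [:: 2; 1; 4; 8; 51; 32];
      Close [:: (4, (14, 17, 34)); (5, (4, 8, 48)); (2, (13, 17, 33)); (1, (34,
        42, 51)); (3, (1, 2, 4))]; Embed 19 27 [:: 32; 16; 4; 8; 51; 1];
      Embed 34 27 [:: 2; 16; 4; 8; 32; 1]; Embed 49 27 [:: 2; 16; 4; 8; 51; 1];
      Branch 28; Embed 6 16 [:: 2; 16; 8; 28; 32; 1];
      Embed 10 16 [:: 2; 16; 4; 28; 32; 1];
      Embed 12 25 [:: 4; 28; 2; 32; 8; 1];
      Embed 13 19 [:: 16; 2; 13; 4; 32; 1];
      Embed 36 16 [:: 4; 17; 2; 51; 8; 1]; Embed 40 16 [:: 8; 17; 2; 51; 4; 1];
      Embed 55 16 [:: 4; 17; 2; 32; 8; 1]; Embed 59 16 [:: 8; 17; 2; 32; 4; 1];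
      Close [:: (3, (25, 32, 8)); (2, (26, 34, 2)); (3, (3, 12, 21)); (2, (56,
        24, 12)); (6, (3, 4, 8)); (8, (1, 2, 4))];
      Embed 13 28 [:: 16; 32; 4; 8; 1; 2]; Embed 28 28 [:: 1; 32; 4; 8; 16; 2];
      Close [:: (9, (14, 17, 33)); (1, (46, 32, 48)); (1, (48, 36, 18)); (5,
        (44, 18, 34)); (27, (16, 17, 62)); (41, (17, 8, 3)); (42, (4, 14, 8));
        (1, (32, 40, 48)); (27, (1, 2, 4)); (14, (4, 48, 17))];
      Embed 3 29 [:: 1; 32; 4; 8; 2; 16]; Embed 17 29 [:: 1; 32; 4; 8; 16; 2];
      Embed 18 29 [:: 2; 32; 4; 8; 16; 1]; Embed 19 29 [:: 32; 2; 4; 8; 51; 1];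
      Embed 33 29 [:: 1; 16; 4; 8; 32; 2]; Embed 34 29 [:: 2; 16; 4; 8; 32; 1];
      Embed 35 29 [:: 16; 2; 4; 8; 51; 1]; Embed 48 29 [:: 16; 2; 4; 8; 32; 1];
      Embed 49 29 [:: 2; 16; 4; 8; 51; 1]; Embed 50 29 [:: 1; 16; 4; 8; 51; 2];
      Branch 9; Embed 10 21 [:: 2; 16; 10; 4; 32; 1];
      Embed 14 16 [:: 1; 2; 16; 32; 9; 4];
      Embed 24 21 [:: 16; 2; 24; 4; 32; 1];
      Embed 28 16 [:: 1; 16; 4; 9; 32; 2];
      Embed 40 21 [:: 32; 2; 40; 4; 16; 1];
      Embed 44 16 [:: 1; 32; 4; 9; 16; 2];
      Embed 59 21 [:: 51; 2; 59; 4; 16; 1];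
      Embed 63 16 [:: 1; 51; 4; 9; 16; 2];
      Close [:: (12, (41, 33, 34)); (6, (32, 2, 16)); (13, (48, 17, 16)); (24,
        (8, 2, 18)); (3, (1, 33, 3)); (11, (8, 9, 41))];
      Embed 5 30 [:: 1; 16; 8; 4; 32; 2]; Embed 6 30 [:: 2; 16; 8; 4; 32; 1];
      Embed 9 30 [:: 1; 16; 4; 8; 32; 2]; Embed 10 30 [:: 2; 16; 4; 8; 32; 1];
      Embed 20 30 [:: 16; 2; 8; 4; 32; 1]; Embed 24 30 [:: 16; 2; 4; 8; 32; 1];
      Embed 36 30 [:: 32; 2; 8; 4; 16; 1]; Embed 40 30 [:: 32; 2; 4; 8; 16; 1];
      Embed 55 30 [:: 51; 2; 8; 4; 16; 1]; Embed 59 30 [:: 51; 2; 4; 8; 16; 1];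
      Close [:: (15, (18, 34, 12)); (1, (35, 51, 8)); (11, (12, 17, 1)); (8,
        (12, 33, 32)); (1, (1, 2, 4))]; Embed 15 31 [:: 2; 4; 16; 32; 8; 1];
      Embed 23 31 [:: 2; 4; 8; 32; 16; 1]; Embed 27 31 [:: 2; 8; 4; 32; 16; 1];
      Embed 29 31 [:: 4; 8; 2; 32; 16; 1]; Embed 30 31 [:: 4; 8; 1; 32; 16; 2];
      Embed 39 31 [:: 2; 4; 8; 16; 32; 1]; Embed 43 31 [:: 2; 8; 4; 16; 32; 1];
      Embed 45 31 [:: 4; 8; 2; 16; 32; 1]; Embed 46 31 [:: 4; 8; 1; 16; 32; 2];
      Embed 51 31 [:: 2; 16; 4; 8; 32; 1]; Embed 53 31 [:: 4; 16; 2; 8; 32; 1];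
      Embed 54 31 [:: 4; 16; 1; 8; 32; 2]; Embed 57 31 [:: 8; 16; 2; 4; 32; 1];
      Embed 58 31 [:: 8; 16; 1; 4; 32; 2]; Embed 60 31 [:: 8; 16; 1; 2; 32; 4];
      Branch 13; Embed 3 29 [:: 2; 8; 16; 32; 3; 4];
      Embed 6 29 [:: 2; 8; 16; 32; 6; 1]; Embed 10 29 [:: 2; 4; 16; 32; 10; 1];
      Embed 17 29 [:: 16; 8; 2; 32; 17; 4];
      Embed 20 29 [:: 16; 8; 2; 32; 20; 1];
      Embed 24 29 [:: 16; 4; 2; 32; 24; 1];
      Embed 33 29 [:: 32; 8; 2; 16; 33; 4];
      Embed 36 29 [:: 32; 8; 2; 16; 36; 1];
      Embed 40 29 [:: 32; 4; 2; 16; 40; 1];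
      Embed 63 31 [:: 16; 32; 1; 4; 13; 2]; Branch 56;
      Embed 5 26 [:: 13; 32; 1; 2; 5; 16]; Embed 9 26 [:: 1; 32; 4; 2; 9; 16];
      Embed 12 26 [:: 4; 32; 1; 2; 12; 16];
      Embed 18 25 [:: 2; 56; 1; 4; 18; 32];
      Embed 34 25 [:: 2; 56; 1; 4; 34; 16];
      Embed 48 26 [:: 56; 4; 16; 2; 48; 1]; Branch 47;
      Fano 11 [:: 2; 4; 8; 1; 16; 47]; Fano 14 [:: 1; 2; 8; 4; 16; 47];
      Fano 25 [:: 1; 8; 16; 2; 4; 56]; Fano 26 [:: 2; 4; 8; 1; 16; 47];
      Fano 28 [:: 4; 8; 16; 1; 2; 56]; Fano 31 [:: 4; 8; 16; 1; 2; 56];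
      Fano 35 [:: 1; 8; 32; 2; 4; 16]; Fano 37 [:: 4; 8; 32; 1; 2; 16];
      Fano 38 [:: 4; 8; 32; 1; 2; 16]; Fano 49 [:: 1; 8; 32; 2; 4; 16];
      Fano 50 [:: 2; 4; 8; 1; 56; 47]; Fano 52 [:: 4; 8; 32; 1; 2; 16];
      Fano 55 [:: 4; 8; 32; 1; 2; 16];
      Close [:: (1, (5, 40, 21)); (1, (18, 2, 40))];
      Embed 19 32 [:: 32; 2; 56; 8; 4; 1];
      Embed 22 32 [:: 32; 1; 56; 16; 2; 4];
      Embed 31 32 [:: 2; 1; 31; 16; 32; 8];
      Embed 35 32 [:: 16; 2; 56; 8; 4; 1];
      Embed 38 32 [:: 16; 1; 56; 32; 2; 4];
      Embed 47 32 [:: 2; 1; 47; 32; 16; 8];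
      Embed 55 32 [:: 2; 1; 55; 56; 16; 8];
      Embed 59 32 [:: 16; 2; 32; 8; 4; 1];
      Embed 62 32 [:: 16; 1; 32; 56; 2; 4]; Branch 44;
      Fano 28 [:: 4; 8; 16; 1; 2; 56]; Fano 37 [:: 4; 8; 32; 1; 2; 16];
      Fano 41 [:: 1; 4; 32; 2; 16; 13]; Fano 52 [:: 4; 8; 32; 1; 2; 16];
      Embed 7 32 [:: 16; 2; 56; 44; 32; 1];
      Embed 11 32 [:: 16; 2; 56; 32; 13; 1];
      Embed 26 32 [:: 2; 1; 26; 16; 56; 4];
      Embed 50 32 [:: 2; 1; 50; 56; 16; 4];
      Close [:: (1, (60, 45, 2)); (1, (17, 1, 2)); (1, (2, 16, 44))];
      Embed 21 33 [:: 1; 2; 21; 16; 32; 8];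
      Embed 25 33 [:: 4; 2; 16; 25; 32; 1];
      Embed 28 33 [:: 1; 2; 16; 28; 32; 4];
      Embed 37 33 [:: 1; 2; 37; 32; 16; 8];
      Embed 41 33 [:: 4; 2; 32; 41; 16; 1];
      Embed 44 33 [:: 1; 2; 32; 44; 16; 4];
      Embed 49 33 [:: 4; 2; 56; 49; 16; 1];
      Embed 52 33 [:: 1; 2; 56; 52; 16; 4];
      Embed 61 33 [:: 1; 2; 61; 56; 16; 8];
      Close [:: (11, (46, 5, 30)); (6, (42, 48, 46)); (12, (10, 4, 1)); (7, (5,
        32, 1)); (9, (27, 43, 1)); (13, (16, 32, 11)); (19, (48, 16, 4))];
      Embed 19 34 [:: 4; 32; 8; 1; 16; 2]; Embed 22 34 [:: 2; 32; 16; 4; 8; 1];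
      Embed 26 34 [:: 2; 32; 16; 8; 4; 1];
      Embed 31 34 [:: 2; 32; 16; 13; 4; 1];
      Embed 35 34 [:: 4; 16; 8; 1; 32; 2]; Embed 38 34 [:: 2; 16; 32; 4; 8; 1];
      Embed 42 34 [:: 2; 16; 32; 8; 4; 1];
      Embed 47 34 [:: 2; 16; 32; 13; 4; 1];
      Embed 49 34 [:: 16; 2; 32; 1; 8; 4]; Embed 52 34 [:: 16; 2; 32; 4; 8; 1];
      Embed 56 34 [:: 16; 2; 32; 8; 4; 1];
      Embed 61 34 [:: 16; 2; 32; 13; 4; 1]; Branch 34;
      Embed 7 22 [:: 4; 32; 8; 16; 34; 1];
      Embed 11 22 [:: 8; 32; 4; 16; 34; 1];
      Embed 14 22 [:: 13; 32; 4; 16; 34; 1];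
      Embed 37 22 [:: 4; 2; 8; 16; 34; 1]; Embed 41 22 [:: 8; 2; 4; 16; 34; 1];
      Embed 44 22 [:: 13; 2; 4; 16; 34; 1];
      Embed 55 22 [:: 4; 16; 8; 2; 34; 1]; Embed 59 22 [:: 8; 16; 4; 2; 34; 1];
      Embed 62 22 [:: 13; 16; 4; 2; 34; 1];
      Close [:: (59, (13, 34, 5)); (7, (12, 34, 8)); (63, (1, 2, 4)); (18, (9,
        32, 8)); (28, (58, 32, 34)); (6, (2, 5, 8)); (25, (12, 32, 60)); (14,
        (32, 18, 27)); (13, (2, 9, 16)); (12, (2, 25, 32))];
      Embed 18 35 [:: 1; 16; 4; 8; 32; 2]; Embed 34 35 [:: 1; 32; 4; 8; 16; 2];
      Embed 48 35 [:: 1; 32; 4; 8; 2; 16];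
      Close [:: (1, (48, 13, 16)); (1, (32, 13, 34)); (1, (13, 18, 2))];
      Embed 7 36 [:: 1; 16; 2; 4; 32; 8]; Embed 11 36 [:: 1; 16; 2; 8; 32; 4];
      Embed 13 36 [:: 1; 16; 4; 8; 32; 2]; Embed 14 36 [:: 2; 16; 4; 8; 32; 1];
      Embed 19 36 [:: 1; 8; 2; 16; 32; 4]; Embed 21 36 [:: 1; 8; 4; 16; 32; 2];
      Embed 22 36 [:: 2; 8; 4; 16; 32; 1]; Embed 25 36 [:: 1; 4; 8; 16; 32; 2];
      Embed 26 36 [:: 2; 4; 8; 16; 32; 1]; Embed 28 36 [:: 4; 2; 8; 16; 32; 1];
      Embed 35 36 [:: 1; 8; 2; 32; 16; 4]; Embed 37 36 [:: 1; 8; 4; 32; 16; 2];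
      Embed 38 36 [:: 2; 8; 4; 32; 16; 1]; Embed 41 36 [:: 1; 4; 8; 32; 16; 2];
      Embed 42 36 [:: 2; 4; 8; 32; 16; 1]; Embed 44 36 [:: 4; 2; 8; 32; 16; 1];
      Embed 49 36 [:: 1; 4; 16; 32; 8; 2]; Embed 50 36 [:: 2; 4; 16; 32; 8; 1];
      Embed 52 36 [:: 4; 2; 16; 32; 8; 1]; Embed 56 36 [:: 8; 2; 16; 32; 4; 1];
      Branch 20; Embed 5 36 [:: 1; 8; 16; 20; 32; 2];
      Embed 6 36 [:: 2; 8; 16; 20; 32; 1];
      Embed 12 36 [:: 8; 2; 16; 20; 32; 1];
      Embed 17 36 [:: 1; 8; 4; 20; 32; 2]; Embed 18 36 [:: 2; 8; 4; 20; 32; 1];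
      Embed 24 36 [:: 4; 2; 8; 20; 32; 1]; Embed 31 30 [:: 20; 2; 32; 4; 8; 1];
      Embed 36 36 [:: 16; 2; 32; 20; 8; 1];
      Embed 48 36 [:: 4; 2; 32; 20; 8; 1]; Embed 55 30 [:: 20; 2; 8; 4; 32; 1];
      Embed 61 30 [:: 20; 8; 2; 4; 32; 1]; Embed 62 30 [:: 20; 8; 1; 4; 32; 2];
      Close [:: (11, (3, 4, 8)); (8, (10, 52, 4)); (32, (4, 43, 20)); (23, (16,
        10, 33)); (1, (6, 16, 34)); (2, (20, 22, 21)); (28, (9, 16, 20)); (24,
        (40, 3, 34))]; Embed 3 37 [:: 8; 16; 1; 32; 2; 4];
      Embed 5 37 [:: 8; 16; 1; 32; 4; 2]; Embed 6 37 [:: 8; 16; 2; 32; 4; 1];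
      Embed 9 37 [:: 4; 16; 1; 32; 8; 2]; Embed 10 37 [:: 4; 16; 2; 32; 8; 1];
      Embed 12 37 [:: 2; 16; 4; 32; 8; 1]; Embed 17 37 [:: 4; 8; 1; 32; 16; 2];
      Embed 18 37 [:: 4; 8; 2; 32; 16; 1]; Embed 20 37 [:: 2; 8; 4; 32; 16; 1];
      Embed 24 37 [:: 2; 4; 8; 32; 16; 1]; Embed 33 37 [:: 4; 8; 1; 16; 32; 2];
      Embed 34 37 [:: 4; 8; 2; 16; 32; 1]; Embed 36 37 [:: 2; 8; 4; 16; 32; 1];
      Embed 40 37 [:: 2; 4; 8; 16; 32; 1]; Embed 48 37 [:: 2; 4; 16; 8; 32; 1];
      Close [:: (3, (40, 36, 33)); (4, (34, 6, 18)); (2, (10, 40, 24)); (6, (3,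
        5, 9)); (1, (12, 6, 36)); (5, (24, 20, 48))]])%num.

Lemma verify_certificate : verify certificate.
Proof. by vm_compute. Qed.

(** * From independent functionals to private elements *)

Section Transversal.
Variables (R : realType) (E : finType) (n : nat) (c : E -> 'cV[bool]_n).
Hypothesis full_c : forall y, cocycle c y = set0 -> y = 0.
Implicit Types (x y z : 'rV[bool]_n) (w : E -> R).
Implicit Types t : 'rV[bool]_n * 'rV[bool]_n * 'rV[bool]_n.

Lemma indep3C12 x y z : indep3 x y z -> indep3 y x z.
Proof.
by rewrite /indep3 (addrC y x) => /and5P[-> -> -> -> /and3P[-> -> ->]].
Qed.

Lemma indep3C23 x y z : indep3 x y z -> indep3 x z y.
Proof.
rewrite /indep3 (addrC z y) (addrAC x z y).
by case/and5P=> [-> -> -> -> /and3P[-> -> ->]].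
Qed.

Lemma addmxx x : x + x = 0.
Proof. by apply/matrixP => i j; rewrite !mxE; case: (x i j). Qed.

(** Since [x + x = 0], replacing [y] by [x + y] merely permutes the seven nonzero combinations. *)
Lemma indep3D x y z : indep3 x y z -> indep3 x (x + y) z.
Proof.
rewrite /indep3 addrA addmxx add0r.
by case/and5P=> [-> -> -> -> /and3P[-> -> ->]].
Qed.

Lemma indep3Dl x y z : indep3 x y z -> indep3 (x + y) y z.
Proof. by rewrite addrC => /indep3C12/indep3D/indep3C12. Qed.

Lemma indep3Dsum x y z : indep3 x y z -> indep3 (x + y + z) y z.
Proof. by move=> /indep3Dl/indep3C23/indep3Dl/indep3C23. Qed.

Lemma in_cocycleD x y e :
  (e \in cocycle c (x + y)) = (e \in cocycle c x) (+) (e \in cocycle c y).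
Proof. by rewrite !inE mulmxDl mxE; do 2!case: (_ 0 0). Qed.

Definition wt w y : R := \sum_(e in cocycle c y) w e.

Definition wt3 w t : R := wt w t.1.1 + wt w t.1.2 + wt w t.2.

Definition transversal3 t : bool :=
  let: (y1, y2, y3) := t in
  [&& [exists e, [&& e \in cocycle c y1, e \notin cocycle c y2
                   & e \notin cocycle c y3]],
      [exists e, [&& e \notin cocycle c y1, e \in cocycle c y2
                   & e \notin cocycle c y3]]
    & [exists e, [&& e \notin cocycle c y1, e \notin cocycle c y2
                   & e \in cocycle c y3]]].

Lemma wt_gt0 w y : (forall e, 0 < w e) -> y != 0 -> 0 < wt w y.
Proof.
move=> w0 y0; have /set0Pn[e ey] : cocycle c y != set0.
  by apply/eqP => /full_c ye; rewrite ye eqxx in y0.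
rewrite /wt (bigD1 e) //= ltr_wpDr // sumr_ge0 // => k _; exact: ltW.
Qed.

(** The three cocycles cut the ground set into eight regions; all comparisons of weights below
    become linear in the weights of these regions. *)
Definition atom w x y z (a b d : bool) : R :=
  \sum_(e | [&& (e \in cocycle c x) == a, (e \in cocycle c y) == b
               & (e \in cocycle c z) == d]) w e.

Lemma atom_ge0 w x y z a b d : (forall e, 0 < w e) -> 0 <= atom w x y z a b d.
Proof. by move=> w0; apply: sumr_ge0 => e _; apply: ltW. Qed.

Lemma atom_ex w x y z a b d : 0 < atom w x y z a b d ->
  exists e, [/\ (e \in cocycle c x) = a, (e \in cocycle c y) = b
               & (e \in cocycle c z) = d].
Proof.
rewrite /atom; case: (pickP (fun e => [&& (e \in cocycle c x) == a,
    (e \in cocycle c y) == b & (e \in cocycle c z) == d])) => [e|no].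
  by move=> /and3P[/eqP ea /eqP eb /eqP ed] _; exists e.
by rewrite big_pred0 ?ltxx.
Qed.

(** The cocycle of a sum is the symmetric difference of the cocycles, so parity decides which
    regions count. *)
Lemma wt_atoms w x y z (t := atom w x y z) :
  [/\ wt w x =
        t true false false + t true true false + t true false true
          + t true true true,
      wt w y =
        t false true false + t true true false + t false true true
          + t true true true,
      wt w z =
        t false false true + t true false true + t false true true
          + t true true true,
      wt w (x + y) =
        t true false false + t true false true + t false true false
          + t false true true
    & wt w (x + z) =
        t true false false + t true true false + t false false true
          + t false true true] /\
      wt w (x + y + z) =
    t true false false + t false true false + t false false true
      + t true true true.
Proof.
have wtE u : wt w u = \sum_e if e \in cocycle c u then w e else 0 := big_mkcond _ _.
have tE a b d : t a b d = \sum_e _ := big_mkcond _ _.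
by split; [split|]; rewrite wtE !tE -!big_split; apply: eq_bigr => e _;
  rewrite /= ?in_cocycleD;
  case: (e \in cocycle c x); case: (e \in cocycle c y);
  case: (e \in cocycle c z); rewrite /= ?addr0 ?add0r.
Qed.

(* If [x] has no private element, comparing the lightest triple with the other
   bases of its span forces ties among the weights of the atoms, and exchanging
   [y] for [x + y] costs nothing. *)
Lemma transversal_swap w x y z : (forall e, 0 < w e) -> indep3 x y z ->
  (forall u, indep3 u.1.1 u.1.2 u.2 -> wt3 w (x, y, z) <= wt3 w u) ->
  ~~ [exists e, [&& e \in cocycle c x, e \notin cocycle c y & e \notin cocycle c z]] ->
  transversal3 (x, x + y, z) /\ wt3 w (x, x + y, z) <= wt3 w (x, y, z).
Proof.
move=> w0 ind min nox; have [x0 _] := andP ind.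
(* The six competing triples replace one member by its sum with one or both of the others. *)
have ixy := indep3D ind.
have ixz := indep3C23 (indep3D (indep3C23 ind)).
have iyx := indep3Dl ind.
have izyz := indep3Dsum ind.
have ixyz := indep3C12 (indep3Dsum (indep3C12 ind)).
have iyyz := indep3C23 (indep3C12 (indep3Dsum (indep3C12 (indep3C23 ind)))).
rewrite (addrC y x) in ixyz; rewrite -addrA addrC in iyyz.
have /= m1 := min (x, x + y, z) ixy.
have /= m2 := min (x, y, x + z) ixz.
have /= m3 := min (x + y, y, z) iyx.
have /= m4 := min (x, x + y + z, z) ixyz.
have /= m5 := min (x, y, x + y + z) iyyz.
have /= m6 := min (x + y + z, y, z) izyz.
move: m1 m2 m3 m4 m5 m6; rewrite /wt3 /=.
have px := wt_gt0 w0 x0; move: px.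
have [[-> -> -> -> ->] ->] := wt_atoms w x y z.
have t0 a b d := atom_ge0 x y z a b d w0.
have : atom w x y z true false false = 0.
  rewrite /atom big_pred0 // => e; apply: contraNF nox => /and3P[/eqP ex /eqP ey /eqP ez].
  by apply/existsP; exists e; rewrite ex ey ez.
have := t0 true true false; have := t0 true false true; have := t0 true true true.
have := t0 false true true; have := t0 false true false; have := t0 false false true.
move: (@atom_ex w x y z true true false) (@atom_ex w x y z false true false)
  (@atom_ex w x y z false false true).
set t100 := atom w x y z true false false; set t110 := atom w x y z true true false.
set t101 := atom w x y z true false true; set t111 := atom w x y z true true true.
set t010 := atom w x y z false true false; set t001 := atom w x y z false false true.
set t011 := atom w x y z false true true.
(* With [t100 = 0], the first two comparisons give [t111 = 0] and [t110 = t101]. Both of these are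
   positive because [x] has positive weight, and [x + y] weighs as much as [y]. The comparisons that
   bring in [x + y + z] for [z] and for [y] make [t010] and [t001] positive. The regions 110, 010,
   001 are the private parts of [x], [x + y], [z] in the new triple. *)
move=> e110 e010 e001 ? ? ? ? ? ? ? ? ? ? ? ? ? ?; split; last by lra.
have /e110[e [ex ey ez]] : 0 < t110 by lra.
have /e010[f [fx fy fz]] : 0 < t010 by lra.
have /e001[g [gx gy gz]] : 0 < t001 by lra.
apply/and3P; split; apply/existsP; [exists e | exists f | exists g];
  by rewrite in_cocycleD ?ex ?ey ?ez ?fx ?fy ?fz ?gx ?gy ?gz.
Qed.

(** A lightest independent triple exists by finiteness. If one of its members lacks a private
    element, symmetry brings that member to the first place and a single exchange suffices. *)
Lemma transversal_le w : (forall e, 0 < w e) ->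
  (exists t, indep3 t.1.1 t.1.2 t.2 /\ wt3 w t <= \sum_e w e) ->
  exists2 t, transversal3 t & wt3 w t <= \sum_e w e.
Proof.
move=> w0 [y0 [ind0 le0]].
have := @Order.TotalTheory.arg_minP _ R _ y0
  (fun y : 'rV_n * 'rV_n * 'rV_n => indep3 y.1.1 y.1.2 y.2) (wt3 w) ind0.
case=> [[[x y] z] /= ind min].
have {y0 ind0 le0} le : wt3 w (x, y, z) <= \sum_e w e.
  exact: le_trans (min _ ind0) le0.
have [tx|nx] := boolP
  [exists e, [&& e \in cocycle c x, e \notin cocycle c y & e \notin cocycle c z]]; last first.
  have [tr le'] := transversal_swap w0 ind min nx.
  by exists (x, x + y, z); last exact: le_trans le.
have [ty|ny] := boolP
  [exists e, [&& e \notin cocycle c x, e \in cocycle c y & e \notin cocycle c z]]; last first.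
  have wtC : wt3 w (y, x, z) = wt3 w (x, y, z) by rewrite /wt3 /= (addrC (wt w y)).
  have [||tr le'] := transversal_swap w0 (indep3C12 ind).
  - by move=> u /min; rewrite wtC.
  - by apply: contra ny => /existsP[e he]; apply/existsP; exists e; rewrite andbCA.
  by exists (y, y + x, z) => //; apply: le_trans le' _; rewrite wtC.
have [tz|nz] := boolP
  [exists e, [&& e \notin cocycle c x, e \notin cocycle c y & e \in cocycle c z]]; last first.
  have wtC : wt3 w (z, x, y) = wt3 w (x, y, z).
    by rewrite /wt3 /= -addrA addrC.
  have [||tr le'] := transversal_swap w0 (indep3C12 (indep3C23 ind)).
  - by move=> u /min; rewrite wtC.
  - apply: contra nz => /existsP[e he]; apply/existsP; exists e.
    by rewrite andbA andbC.
  by exists (z, z + x, y) => //; apply: le_trans le' _; rewrite wtC.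
by exists (x, y, z) => //; apply/and3P.
Qed.

(** Adding [eps] to every weight makes all weights positive. As there are finitely many triples, the
    transversal triple lightest for [w] satisfies the bound up to every positive error, hence
    exactly. *)
Lemma transversal_measure w : (forall e, 0 <= w e) ->
  (forall v : E -> R, (forall e, 0 <= v e) -> exists t,
     indep3 t.1.1 t.1.2 t.2 /\ wt3 v t <= \sum_e v e) ->
  exists2 t, transversal3 t & wt3 w t <= \sum_e w e.
Proof.
move=> w0 gc.
have tr_eps eps : 0 < eps -> exists2 t, transversal3 t &
    wt3 w t <= \sum_e w e + eps * #|E|%:R.
  move=> eps0; pose v e := w e + eps.
  have v0 e : 0 < v e by rewrite /v ltr_wpDl.
  have [|y ty le] := transversal_le v0; first by apply: gc => e; apply: ltW.
  exists y => //; have wv u : wt w u <= wt v u.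
    by apply: ler_sum => e _; rewrite /v lerDl ltW.
  have := le; rewrite /v big_split /= sumr_const mulr_natr; apply: le_trans.
  by rewrite /wt3 !lerD.
(* Any [eps] would do: this only supplies a transversal triple from which to minimize. *)
have [y0 t0 _] := tr_eps 1 ltr01.
have := @Order.TotalTheory.arg_minP _ R _ y0 transversal3 (wt3 w) t0.
case=> y ty min; exists y => //; apply/ler_addgt0Pr => eps eps0.
(* The successor keeps the denominator nonzero even when [E] is empty. *)
have [|u tu le] := tr_eps (eps / #|E|.+1%:R); first by rewrite divr_gt0 ?ltr0n.
apply: le_trans (min u tu) (le_trans le _); rewrite lerD2l.
rewrite mulrAC ler_pdivrMr ?ltr0n // ler_wpM2l ?ltW //.
by rewrite ltr_nat.
Qed.

End Transversal.

(** * Binary representation of a regular matroid *)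

Section BinaryMatroid.
Variables (E : finType) (M : matroid E) (n : nat) (c : E -> 'cV[bool]_n).
Implicit Types (B X C : {set E}) (y : 'rV[bool]_n).

(** Representability in dual form: a family of vectors spans exactly when no nonzero functional
    vanishes on it. The two halves say that bases span and that spanning sets contain bases. *)
Definition binary_represents : Prop :=
  (forall B y, base M B -> [disjoint B & cocycle c y] -> y = 0) /\
  (forall X, (forall y, [disjoint X & cocycle c y] -> y = 0) ->
     exists2 B, base M B & B \subset X).

(** Among the cocycles through [e] inside that of [y], a smallest one is a cocircuit. It meets every
    base; and for [f] in it, its complement together with [f] spans, since a nonzero functional
    vanishing there would yield a smaller cocycle through [e]. *)
Lemma cocircuit_in_cocycle y e : binary_represents -> e \in cocycle c y ->
  exists2 C, cocircuit M C & (e \in C) && (C \subset cocycle c y).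
Proof.
move=> [base0 spanning] ey.
pose P z := (e \in cocycle c z) && (cocycle c z \subset cocycle c y).
have Py : P y by rewrite /P ey subxx.
case: (@arg_minnP _ y P (fun z => #|cocycle c z|) Py) => z /andP[ez zy] minz.
exists (cocycle c z); last by rewrite ez.
have cocycle0 u : u = 0 -> cocycle c u = set0.
  by move=> ->; apply/setP => k; rewrite !inE mul0mx mxE.
apply/minsetP; split=> [|X nX XD].
  apply/existsP => -[B /andP[bB]]; rewrite disjoint_sym => /(base0 _ _ bB)/cocycle0 z0.
  by rewrite z0 inE in ez.
apply/eqP; rewrite eqEsubset XD; apply: contraR nX => /subsetPn[f fD fX].
have [u|B bB Bf] := spanning (f |: ~: cocycle c z).
  rewrite disjoints_subset => sub; apply/eqP/negPn/negP => u0.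
  have fu : f \notin cocycle c u.
    by have := subsetP sub f (setU11 _ _); rewrite inE.
  have uz : cocycle c u \subset cocycle c z.
    rewrite -setCS; apply: subset_trans sub; exact: subsetUr.
  (* The cocycle of [z] is the disjoint union of those of [u] and [z + u], both smaller; whichever
     contains [e] contradicts minimality. *)
  have [eu|eu] := boolP (e \in cocycle c u).
    have : P u by rewrite /P eu (subset_trans uz).
    move=> /minz; rewrite leqNgt => /negP; apply; apply: proper_card.
    by rewrite properE uz; apply/subsetPn; exists f.
  have zu : cocycle c (z + u) = cocycle c z :\: cocycle c u.
    apply/setP => k; rewrite in_cocycleD in_setD; have := subsetP uz k.
    by case: (k \in cocycle c u) => [/(_ isT)->|_]; rewrite ?addbF.
  have : P (z + u).
    rewrite /P zu in_setD eu ez /=; apply: subset_trans zy; exact: subsetDl.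
  move=> /minz; rewrite leqNgt zu => /negP; apply; apply: proper_card.
  have [k ku] : exists k, k \in cocycle c u.
    apply/set0Pn; apply: contra_neq u0 => cu0.
    have [B0 bB0 _] := maxset_exists (indep0 M).
    by apply: (base0 _ _ bB0); rewrite cu0 -setI_eq0 setI0.
  rewrite properE subsetDl; apply/subsetPn; exists k; rewrite ?(subsetP uz) //.
  by rewrite in_setD ku.
apply/existsP; exists B; rewrite bB /= disjoint_sym.
apply: disjointWl Bf _; rewrite disjoints_subset; apply/subsetP => k.
rewrite !inE => /orP[/eqP->//|]; apply: contra => /(subsetP XD).
by rewrite inE.
Qed.

End BinaryMatroid.

(** * Bases, rank and selected columns *)

Lemma base_card (E : finType) (M : matroid E) B : base M B -> #|B| = rank M.
Proof.
move=> bB; have [indB _] := maxsetP bB.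
apply/eqP; rewrite eqn_leq (leq_bigmax_cond (F := fun I : {set E} => #|I|)) //=.
have [I0 indI ->] : {I0 | indep M I0 & rank M = #|I0|}.
  by apply: eq_bigmax_cond; apply/card_gt0P; exists set0; apply: indep0.
have [B' bB' /andP[sI _]] := indep_extend indI bB.
by rewrite (card_base bB bB') subset_leq_card.
Qed.

Lemma indep_base (E : finType) (M : matroid E) B :
  indep M B -> #|B| = rank M -> base M B.
Proof.
move=> indB cB; apply/maxsetP; split=> // X indX sBX; apply/eqP.
rewrite eq_sym eqEcard sBX cB.
exact: (leq_bigmax_cond (F := fun I : {set E} => #|I|)).
Qed.

Lemma base_enum (E : finType) (M : matroid E) B : base M B ->
  exists2 h : 'I_(rank M) -> E, injective h & B = [set h i | i in 'I_(rank M)].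
Proof.
move=> /base_card; move: (rank M) => r <-.
exists enum_val; first exact: enum_val_inj.
apply/setP => e; apply/idP/imsetP => [eB|[i _ ->]]; last exact: enum_valP.
by exists (enum_rank_in eB e); rewrite ?enum_rankK_in.
Qed.

Definition cols (T : Type) m (E : finType) (A : 'M[T]_(m, #|E|)) k
    (h : 'I_k -> E) : 'M[T]_(m, k) :=
  colsub (fun i => enum_rank (h i)) A.

Lemma row_selection (F : fieldType) m n (A : 'M[F]_(m, n)) r : \rank A = r ->
  exists2 f : 'I_r -> 'I_m, injective f & exists K, A = K *m rowsub f A.
Proof.
move=> <-; exists (maxrankfun A); first exact: maxrankfun_inj.
by apply/submxP; rewrite eq_maxrowsub.
Qed.

Section Columns.
Variables (F : fieldType) (m : nat) (E : finType) (A : 'M[F]_(m, #|E|)).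

(** Freeness does not depend on the order of the family, so the columns can be listed along [h]
    instead of [enum], which turns it into a rank condition on a matrix. *)
Lemma free_cols k (h : 'I_k -> E) : injective h ->
  free [seq col (enum_rank e) A | e <- enum [set h i | i in 'I_k]]
    = row_free (cols A h)^T.
Proof.
move=> inj_h.
have -> : free [seq col (enum_rank e) A | e <- enum [set h i | i in 'I_k]]
    = free [tuple col (enum_rank (h i)) A | i < k].
  have -> : [tuple col (enum_rank (h i)) A | i < k]
      = [seq col (enum_rank e) A | e <- map h (enum 'I_k)] :> seq _.
    by rewrite -map_comp /= enumT.
  apply: perm_free.
  apply: perm_map; apply: uniq_perm; first exact: enum_uniq.
    by rewrite (map_inj_uniq inj_h) enum_uniq.
  move=> e; rewrite mem_enum; apply/imsetP/mapP => -[i _ ->]; exists i => //.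
  by rewrite mem_enum.
have sumE (u : 'I_k -> F) :
    \sum_i u i *: [tuple col (enum_rank (h i)) A | i < k]`_i = cols A h *m \col_i u i.
  apply/matrixP => i j; rewrite summxE !mxE; apply: eq_bigr => l _.
  by rewrite -tnth_nth tnth_mktuple !mxE mulrC.
apply/freeP/idP => [fr|rf u].
  apply: inj_row_free => v /(congr1 trmx); rewrite trmx_mul trmxK trmx0 => v0.
  apply/matrixP => i j; rewrite ord1 mxE; apply: (fr (fun j => v 0 j)).
  by rewrite sumE -[RHS]v0; congr (_ *m _); apply/matrixP => a b; rewrite !mxE ord1.
rewrite sumE => u0 i.
have : (\col_i u i)^T = 0 :> 'rV_k.
  by apply: (row_free_inj rf); rewrite mul0mx -trmx_mul u0 trmx0.
by move=> /matrixP/(_ 0 i); rewrite !mxE.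
Qed.

(** A base gives independent columns, and a maximal independent choice of columns gives an
    independent set. *)
Lemma rank_represents (M : matroid E) : represents A M -> \rank A = rank M.
Proof.
move=> rep; apply/eqP; rewrite eqn_leq; apply/andP; split; last first.
  have [B bB _] := maxset_exists (indep0 M).
  have [h inj_h Bh] := base_enum bB; have [] := maxsetP bB.
  rewrite Bh rep free_cols // /row_free => /eqP rk _; rewrite -rk.
  have -> : cols A h = A *m cols 1%:M h by rewrite /cols mulmx_colsub mulmx1.
  by rewrite mxrank_tr mxrankM_maxl.
pose h i := enum_val (maxrankfun A^T i).
have inj_h : injective h by move=> i j /enum_val_inj/maxrankfun_inj.
have : indep M [set h i | i in 'I__].
  rewrite rep free_cols //; have := maxrowsub_free A^T.
  congr (row_free _); apply/matrixP => i j.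
  by rewrite !mxE /h enum_valK.
move/(leq_bigmax_cond (F := fun I : {set E} => #|I|)).
by rewrite card_imset // card_ord mxrank_tr.
Qed.

(** The discarded rows are combinations of the kept ones, so no dependency among columns is gained
    by discarding them. *)
Lemma row_free_cols_rowsub r (f : 'I_r -> 'I_m) K k (h : 'I_k -> E) :
  A = K *m rowsub f A -> row_free (cols A h)^T = row_free (cols (rowsub f A) h)^T.
Proof.
move=> AK; rewrite /row_free !mxrank_tr; congr (_ == _).
apply/eqP; rewrite eqn_leq; apply/andP; split.
  by rewrite {1}AK /cols -mulmx_colsub mxrankM_maxr.
have -> : cols (rowsub f A) h = rowsub f (cols A h).
  by apply/matrixP => i j; rewrite !mxE.
by rewrite rowsubE mxrankM_maxr.
Qed.

End Columns.

(** * From real to integer representations *)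

Section Regular.
Variables (R : realType) (E : finType).

Lemma det_colsub_noninj (S : comPzRingType) r p (A : 'M[S]_(r, p)) (h : 'I_r -> 'I_p) :
  ~~ injectiveb h -> \det (colsub h A) = 0.
Proof.
move=> /injectivePn[i [j ij hij]]; rewrite -det_tr.
by apply: (determinant_alternate ij) => k; rewrite !mxE hij.
Qed.

(** Only maximal minors are kept, a condition preserved under change of basis; a repeated column
    gives 0, so [h] need not be injective. *)
Definition unimodular r p (Z : 'M[int]_(r, p)) : Prop :=
  forall h : 'I_r -> 'I_p, \det (colsub h Z) \in [:: 0; 1; -1].

(** Keeping [rank M] independent rows makes bases correspond to nonzero maximal minors, and integer
    entries allow reduction modulo 2. *)
Lemma unimodular_representation (M : matroid E) : regular R M ->
  exists2 Z : 'M[int]_(rank M, #|E|), unimodular Z &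
    forall h : 'I_(rank M) -> E, injective h ->
      indep M [set h i | i in 'I_(rank M)] = (\det (cols Z h) != 0).
Proof.
case=> m [A [tuA rep]].
have [f inj_f [K AK]] := row_selection (rank_represents rep).
pose N := rowsub f A.
have entry i j : A i j \in [:: 0; 1; -1].
  have := tuA 1 (fun=> i) (fun=> j) _ _; rewrite det_mx11 mxE.
  by apply=> a b _; rewrite !ord1.
(* The entries are minors of order 1, so the last branch is reached only at -1. *)
pose Z := \matrix_(i, j) (if N i j == 0 then 0 else if N i j == 1 then 1 else -1 : int).
have ZN : map_mx intr Z = N.
  apply/matrixP => i j; rewrite !mxE; have := entry (f i) j.
  rewrite !inE => /or3P[] /eqP ->; rewrite ?eqxx ?oner_eq0 //.
  rewrite oppr_eq0 oner_eq0 -subr_eq0 -opprD oppr_eq0 -(natrD _ 1 1).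
  by rewrite pnatr_eq0 rmorphN.
have detZ k (h : 'I_k -> 'I_#|E|) (g : 'I_k -> 'I_(rank M)) :
    (\det (mxsub g h Z))%:~R = \det (mxsub g h N) :> R.
  by rewrite -ZN -map_mxsub det_map_mx.
exists Z => [h|h inj_h].
  have [/injectiveP inj_h|] := boolP (injectiveb h); last first.
    by move=> /(det_colsub_noninj Z) ->.
  have := tuA _ f h inj_f inj_h.
  have -> : mxsub f h A = mxsub id h N by apply/matrixP => i j; rewrite !mxE.
  rewrite -detZ !inE; set d := \det _.
  by rewrite -(rmorphN1 intr) /= -[0]/(0%:~R) -[1]/(1%:~R) !eqr_int.
rewrite rep free_cols // (row_free_cols_rowsub _ AK) row_free_unit unitmx_tr.
rewrite unitmxE unitfE -/N -(intr_eq0 R) /cols detZ //.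
Qed.

End Regular.

(** * Reduction modulo 2 *)

Section Mod2.
Variables (E : finType) (r : nat) (Z : 'M[int]_(r, #|E|)).
Hypothesis uZ : unimodular Z.

Definition mod2 (e : E) : 'cV[bool]_r := map_mx intr (col (enum_rank e) Z).

(** A minor equal to 0, 1 or -1 is nonzero exactly when it is odd, so reduction modulo 2 keeps the
    bases. *)
Lemma unitmx_mod2 (h : 'I_r -> E) :
  (cols (map_mx intr Z : 'M[bool]_(r, #|E|)) h \in unitmx) = (\det (cols Z h) != 0).
Proof.
rewrite /cols -map_mxsub unitmxE unitfE det_map_mx.
by have := uZ (fun i => enum_rank (h i)); rewrite !inE => /or3P[] /eqP ->.
Qed.

Lemma mul_cols_mod2 k (h : 'I_k -> E) (y : 'rV[bool]_r) j :
  (y *m cols (map_mx intr Z) h) 0 j = (h j \in cocycle mod2 y).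
Proof. by rewrite inE !mxE; apply: eq_bigr => i _; rewrite !mxE. Qed.

(** The columns of a base form an invertible matrix, which no nonzero functional kills. Conversely,
    if no nonzero functional vanishes on [X], its columns have rank [r], and [r] independent ones
    among them form a base. *)
Lemma binary_represents_mod2 (M : matroid E) : rank M = r ->
  (forall h : 'I_r -> E, injective h ->
     indep M [set h i | i in 'I_r] = (\det (cols Z h) != 0)) ->
  binary_represents M mod2.
Proof.
move=> rM rep; split=> [B y bB|X spanX].
  have := base_enum bB; rewrite rM => -[h inj_h Bh] dis.
  have uh : cols (map_mx intr Z : 'M[bool]__) h \in unitmx.
    by rewrite unitmx_mod2 -rep // -Bh; case/maxsetP: bB.
  apply: (can_inj (mulmxK uh)); rewrite mul0mx; apply/rowP => j.
  by rewrite mul_cols_mod2 mxE (disjointFr dis) // Bh imset_f.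
pose P : 'M[bool]__ := cols (map_mx intr Z) (fun i : 'I_#|X| => enum_val i).
have rP : \rank P^T = r.
  rewrite mxrank_tr; apply/eqP/inj_row_free => y yP; apply: spanX.
  rewrite disjoints_subset; apply/subsetP => e eX; rewrite inE.
  move/rowP/(_ (enum_rank_in eX e)): yP.
  by rewrite mul_cols_mod2 enum_rankK_in // mxE => ->.
have [f inj_f [K PK]] := row_selection rP.
pose h i := enum_val (f i).
have inj_h : injective h by move=> i j /enum_val_inj/inj_f.
have uh : cols (map_mx intr Z : 'M[bool]__) h \in unitmx.
  rewrite -unitmx_tr -row_free_unit /row_free eqn_leq rank_leq_row -{1}rP {1}PK.
  have -> : rowsub f P^T = (cols (map_mx intr Z) h)^T.
    by apply/matrixP => i j; rewrite !mxE.
  exact: mxrankM_maxr.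
exists [set h i | i in 'I_r]; last first.
  by apply/subsetP => _ /imsetP[i _ ->]; apply: enum_valP.
apply: indep_base; first by rewrite rep // -unitmx_mod2.
by rewrite card_imset // card_ord rM.
Qed.

End Mod2.

(** * Absence of Fano minors *)

Lemma det3 (S : comNzRingType) (f : nat -> nat -> S) :
  \det (\matrix_(i < 3, j < 3) f i j) =
    f 0%N 0%N * (f 1%N 1%N * f 2 2 - f 1%N 2 * f 2 1%N) -
    f 0%N 1%N * (f 1%N 0%N * f 2 2 - f 1%N 2 * f 2 0%N) +
    f 0%N 2 * (f 1%N 0%N * f 2 1%N - f 1%N 1%N * f 2 0%N).
Proof.
rewrite (expand_det_row _ ord0) !big_ord_recl big_ord0 /cofactor.
rewrite !(expand_det_row _ (ord0 : 'I_2)) !big_ord_recl !big_ord0 /cofactor.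
rewrite !det_mx11 !mxE /= /bump /= ?add1n ?add0n ?addn0 /=.
ring.
Qed.

(* In a signing of the Fano configuration with zero 2x2 minors, the two terms of
   the remaining 3x3 minor are equal units, so that it is 2 or -2. *)
Lemma fano_signs (a b c d e f p q r : int) :
  a \in [:: 1; -1] -> b \in [:: 1; -1] -> p \in [:: 1; -1] -> q \in [:: 1; -1] ->
  a * q - b * p \in [:: 0; 1; -1] ->
  c \in [:: 1; -1] -> d \in [:: 1; -1] -> r \in [:: 1; -1] ->
  c * r - d * p \in [:: 0; 1; -1] ->
  e \in [:: 1; -1] -> f \in [:: 1; -1] ->
  e * r - f * q \in [:: 0; 1; -1] ->
  a * e * d + c * b * f \notin [:: 0; 1; -1].
Proof.
rewrite !inE.
by do 4![case/orP=> /eqP->]; rewrite //= => _; do 3![case/orP=> /eqP->];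
  rewrite //= => _; do 2![case/orP=> /eqP->].
Qed.

Lemma eq_in_seq (T : eqType) (s : seq T) (x y : T) : x = y -> x \in s -> y \in s.
Proof. by move=> ->. Qed.

Section FanoFree.
Variables (E : finType) (Z : 'M[int]_(6, #|E|)).
Hypothesis uZ : unimodular Z.

(** A Fano minor modulo 2 lifts to the integers: the basis showing it has determinant 1 or -1, and
    in its coordinates the four remaining points become columns of signs that violate
    [fano_signs]. *)
Lemma fano_free_mod2 : fano_free (mod2 Z).
Proof.
move=> B uB /fin_all_exists[h hB] fan.
have BE : B = cols (map_mx intr Z) h.
  by apply/matrixP => i j; have /matrixP/(_ i 0) := hB j; rewrite !mxE.
have := uZ (fun i => enum_rank (h i)); rewrite -/(cols Z h).
have := uB; rewrite BE unitmx_mod2 // => d0.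
rewrite in_cons (negPf d0) /= => d1.
have uh : cols Z h \in unitmx by rewrite unitmxE; move: d1; rewrite !inE => /orP[] /eqP->.
pose N := invmx (cols Z h) *m Z.
have uN g : \det (cols N g) \in [:: 0; 1; -1].
  rewrite /N /cols -mulmx_colsub det_mulmx det_inv -/(cols Z h).
  have := uZ (fun i => enum_rank (g i)).
  by move: d1; rewrite !inE => /orP[] /eqP-> /or3P[] /eqP->.
have Nh : cols N h = 1%:M by rewrite /N /cols -mulmx_colsub mulVmx.
have ZN : cols Z h *m N = Z by rewrite mulKVmx.
move: N uN Nh ZN => N uN Nh ZN {d0 d1 uh}.
pose p i e := N (inord i) (enum_rank e).
have coordsE e : coords B (mod2 Z) e = ((p 0 e)%:~R, (p 1%N e)%:~R, (p 2%N e)%:~R).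
  rewrite /coords; have -> : invmx B *m mod2 Z e = map_mx intr (col (enum_rank e) N).
    apply: (can_inj (mulKmx uB)); rewrite mulKVmx // BE /cols -map_mxsub -map_mxM.
    by congr (map_mx _ _); rewrite -/(cols Z h) -[in LHS]ZN !colE mulmxA.
  by rewrite !mxE.
(* Three columns are completed by the last three basis columns. The matrix is then block triangular
   with an identity block, so the minor on the first three rows is itself a maximal minor. *)
have minor (q : 'I_3 -> E) :
    \det (\matrix_(i < 3, j < 3) N (inord i) (enum_rank (q j))) \in [:: 0; 1; -1].
  pose g (j : 'I_(3 + 3)) := if split j is inl k then q k else h j.
  have : \det (cols N g : 'M_(3 + 3)) \in [:: 0; 1; -1] := uN g.
  rewrite -(@submxK _ 3 3 3 3 (cols N g)).
  have -> : ursubmx (cols N g : 'M_(3 + 3)) = 0.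
    apply/matrixP => i j; have /matrixP/(_ (lshift 3 i) (rshift 3 j)) := Nh.
    rewrite !mxE /g (unsplitK (inr _ j)) => ->.
    by rewrite -val_eqE /= ltn_eqF // ltn_addr.
  have -> : drsubmx (cols N g : 'M_(3 + 3)) = 1%:M.
    apply/matrixP => i j; have /matrixP/(_ (rshift 3 i) (rshift 3 j)) := Nh.
    rewrite !mxE /g (unsplitK (inr _ j)) => ->.
    by rewrite -val_eqE /= eqn_add2l.
  rewrite det_lblock det1 mulr1.
  suff -> : ulsubmx (cols N g : 'M_(3 + 3))
    = \matrix_(i, j) N (inord i) (enum_rank (q j)) by [].
  apply/matrixP => i j; rewrite !mxE /g (unsplitK (inl _ j)); congr (N _ _).
  by apply: val_inj; rewrite /= inordK // (leq_trans (ltn_ord i)).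
have ph i (j : 'I_6) : (i < 6)%N -> p i (h j) = (i == j)%:R.
  move=> i6; have /matrixP/(_ (inord i) j) := Nh; rewrite !mxE /p => ->.
  by rewrite -val_eqE /= inordK.
have minor3 (e0 e1 e2 : E) :
    p 0 e0 * (p 1%N e1 * p 2 e2 - p 1%N e2 * p 2 e1) -
    p 0 e1 * (p 1%N e0 * p 2 e2 - p 1%N e2 * p 2 e0) +
    p 0 e2 * (p 1%N e0 * p 2 e1 - p 1%N e1 * p 2 e0) \in [:: 0; 1; -1].
  rewrite -(det3 (fun i j => p i (nth e0 [:: e0; e1; e2] j))).
  by have := minor (fun j => nth e0 [:: e0; e1; e2] j).
have ph0 i : (i < 6)%N -> p i (h (inord 0)) = (i == 0)%:R by move/ph->; rewrite inordK.
have ph1 i : (i < 6)%N -> p i (h (inord 1)) = (i == 1)%:R by move/ph->; rewrite inordK.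
have ph2 i : (i < 6)%N -> p i (h (inord 2)) = (i == 2)%:R by move/ph->; rewrite inordK.
pose phE := (ph0, ph1, ph2).
(* With basis columns in the other two places, the minor reduces to one entry, up to no sign
   change. *)
have p0 e : p 0 e \in [:: 0; 1; -1].
  by have := minor3 e (h (inord 1)) (h (inord 2)); rewrite !phE //=; apply: eq_in_seq; ring.
have p1 e : p 1%N e \in [:: 0; 1; -1].
  by have := minor3 (h (inord 0)) e (h (inord 2)); rewrite !phE //=; apply: eq_in_seq; ring.
have p2 e : p 2 e \in [:: 0; 1; -1].
  by have := minor3 (h (inord 0)) (h (inord 1)) e; rewrite !phE //=; apply: eq_in_seq; ring.
have odd01 (m : int) : m \in [:: 0; 1; -1] -> m%:~R = true -> m \in [:: 1; -1].
  by rewrite !inE => /or3P[] /eqP->.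
have even01 (m : int) : m \in [:: 0; 1; -1] -> m%:~R = false -> m = 0.
  by rewrite !inE => /or3P[] /eqP->.
have [x0] := fan (true, true, false) isT; rewrite coordsE.
move=> [/(odd01 _ (p0 _)) a /(odd01 _ (p1 _)) b /(even01 _ (p2 _)) z0].
have [x1] := fan (true, false, true) isT; rewrite coordsE.
move=> [/(odd01 _ (p0 _)) c /(even01 _ (p1 _)) z1 /(odd01 _ (p2 _)) d].
have [x2] := fan (false, true, true) isT; rewrite coordsE.
move=> [/(even01 _ (p0 _)) z2 /(odd01 _ (p1 _)) e /(odd01 _ (p2 _)) f].
have [x3] := fan (true, true, true) isT; rewrite coordsE.
move=> [/(odd01 _ (p0 _)) p' /(odd01 _ (p1 _)) q /(odd01 _ (p2 _)) r].
(* With one basis column, the minor reduces to a minor of order 2, up to sign. *)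
have m1 : p 0 x0 * p 1%N x3 - p 1%N x0 * p 0 x3 \in [:: 0; 1; -1].
  by have := minor3 x0 x3 (h (inord 2)); rewrite !phE //=; apply: eq_in_seq; ring.
have m2 : p 0 x1 * p 2 x3 - p 2 x1 * p 0 x3 \in [:: 0; 1; -1].
  by have := minor3 x1 (h (inord 1)) x3; rewrite !phE //=; apply: eq_in_seq; ring.
have m3 : p 1%N x2 * p 2 x3 - p 2 x2 * p 1%N x3 \in [:: 0; 1; -1].
  by have := minor3 (h (inord 0)) x2 x3; rewrite !phE //=; apply: eq_in_seq; ring.
have /negP := fano_signs a b p' q m1 c d r m2 e f m3; apply.
have := minor3 x1 x0 x2; rewrite z0 z1 z2; apply: eq_in_seq; ring.
Qed.

End FanoFree.

(** * Assembly of the cocircuits *)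

Lemma light_triples_mod2 (R : realType) (E : finType) (M : matroid E)
    (Z : 'M[int]_(6, #|E|)) : unimodular Z -> rank M = 6%N ->
  (forall h : 'I_6 -> E, injective h ->
     indep M [set h i | i in 'I_6] = (\det (cols Z h) != 0)) ->
  light_triples R (mod2 Z).
Proof.
move=> uZ rM rep; have [B bB _] := maxset_exists (indep0 M).
have := base_enum bB; rewrite rM => -[h inj_h Bh].
have uh : cols (map_mx intr Z : 'M[bool]__) h \in unitmx.
  by rewrite unitmx_mod2 // -rep // -Bh; case/maxsetP: bB.
(* In the coordinates given by a base, its columns are the unit vectors, which form the root pattern
   of the search. *)
apply: (forces_light_unit uh (fano_free_mod2 uZ) _
  (verify_sound verify_certificate)) => m.
move=> /(nthP 0%num)[i i6 <-]; exists (h (Ordinal (i6 : (i < 6)%N))).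
rewrite (vec_std_basis (Ordinal (i6 : (i < 6)%N))) -colE.
by apply/matrixP => k l; rewrite !mxE.
Qed.

Theorem theorem1 (R : realType) (E : finType) (M : matroid E) (mu : E -> R)
    (hreg : regular R M) (hrank : rank M = 6%N) (hmu : prob_dist mu) :
  exists C : 'I_3 -> {set E},
    [/\ forall i, cocircuit M (C i),
        \sum_i \sum_(e in C i) mu e <= 1
      & forall h i j : 'I_3, [set h; i; j] = [set: 'I_3] ->
          ~~ (C h \subset C i :|: C j)].
Proof.
have [mu0 mu1] := hmu.
move: (unimodular_representation hreg); rewrite hrank => -[Z uZ rep].
have repM := binary_represents_mod2 uZ hrank rep.
(* A base meets the cocycle of every nonzero functional. *)
have full y : cocycle (mod2 Z) y = set0 -> y = 0.
  move=> y0; have [B bB _] := maxset_exists (indep0 M).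
  by apply: (repM.1 B y bB); rewrite y0 -setI_eq0 setI0.
have [[[y1 y2] y3] tr le] :=
  transversal_measure full mu0 (light_triples_mod2 uZ hrank rep).
pose y (i : 'I_3) := nth y1 [:: y1; y2; y3] i.
(* The private elements [p i]: the cocircuits are chosen through them, so they remain private after
   shrinking the cocycles. *)
have /fin_all_exists[p py] (i : 'I_3) :
    exists e, forall j, (e \in cocycle (mod2 Z) (y j)) = (i == j).
  have /and3P[/existsP[e1 /and3P[e11 e12 e13]] /existsP[e2 /and3P[e21 e22 e23]]
              /existsP[e3 /and3P[e31 e32 e33]]] := tr.
  case: i => [[|[|[|]]]] i3 //; [exists e1|exists e2|exists e3];
    by case=> [[|[|[|]]]] j3 //=; apply/idP; rewrite /y /=; apply/negP.
have /fin_all_exists2[C cocC /(_ _)/andP CP] i :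
    exists2 C, cocircuit M C & (p i \in C) && (C \subset cocycle (mod2 Z) (y i)).
  by apply: cocircuit_in_cocycle; rewrite ?py.
exists C; split=> // [|h i j hij].
  apply: le_trans (_ : wt3 (mod2 Z) mu (y1, y2, y3) <= 1); last by rewrite -mu1.
  rewrite !big_ord_recl big_ord0 addr0 addrA /wt3 /wt /=.
  have leC i : \sum_(e in C i) mu e <= \sum_(e in cocycle (mod2 Z) (y i)) mu e.
    have [_ sub] := CP i; rewrite [leRHS](big_setID (C i)) /= (setIidPr sub).
    by rewrite lerDl sumr_ge0.
  have [[l0 l1] l2] :=
    (leC ord0, leC (lift ord0 ord0), leC (lift ord0 (lift ord0 ord0))).
  exact: lerD (lerD l0 l1) l2.
(* Three indices that exhaust ['I_3] are distinct, by counting. *)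
have card3 : #|[set h; i; j]| = 3%N by rewrite hij cardsT card_ord.
have notin k : h != k -> p h \notin C k.
  move=> hk; have [_ /subsetP sub] := CP k; apply: contra hk => /sub.
  by rewrite py.
apply/subsetPn; exists (p h); first by have [] := CP h.
have cards2_neq3 (a b : 'I_3) : #|[set a; b]| != 3%N.
  by rewrite cards2; case: (a != b).
have hi : h != i.
  apply/eqP => hi; move: card3; rewrite -hi setUid => /eqP.
  exact/negP/cards2_neq3.
have hj : h != j.
  apply/eqP => hj; move: card3; rewrite -hj setUAC setUid => /eqP.
  exact/negP/cards2_neq3.
by rewrite in_setU negb_or (notin i hi) (notin j hj).
Qed.
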